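(* Let $A$ and $B$ be unital $C^*$-algebras and let $\iota\colon A\to B$ be a unital $*$-homomorphism. Suppose that the amplification $\iota^{(2)}\colon M_2(A)\to M_2(B)$ does not have real rank zero. Then: (1) $\iota$ is not a point-norm limit of compositions of two real rank zero homomorphisms; that is, there is no net of pairs of $*$-homomorphisms $\alpha_\lambda\colon A\to C_\lambda$, $\beta_\lambda\colon C_\lambda\to B$, with $C_\lambda$ a $C^*$-algebra and both $\alpha_\lambda$ and $\beta_\lambda$ of real rank zero, such that $\beta_\lambda(\alpha_\lambda(a))\to\iota(a)$ in norm for every $a\in A$; and (2) $\iota$ is not approximately Murray--von Neumann equivalent to any composition $\beta\alpha$ of two $*$-homomorphisms $\alpha\colon A\to C$ and $\beta\colon C\to B$ of real rank zero, with $C$ a $C^*$-algebra.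
   Context: All homomorphisms are $*$-homomorphisms and are not assumed unital unless stated; the intermediate $C^*$-algebras need not be unital. For a $C^*$-algebra $B$ and $b\in B_+$, write $\operatorname{Her}_B(b)=\overline{bBb}$. A homomorphism $\theta\colon A\to B$ of $C^*$-algebras has real rank zero if $\operatorname{Her}_B(\theta(a))$ has an approximate unit of projections for every $a\in A_+$. For $n\geq 1$, $\theta^{(n)}\colon M_n(A)\to M_n(B)$ denotes the entrywise amplification. Homomorphisms $\theta,\eta\colon A\to B$ are approximately Murray--von Neumann equivalent if there is a net of contractions $(v_\lambda)$ in $B$ such that for all $a\in A$, $\|v_\lambda^*\theta(a)v_\lambda-\eta(a)\|\to 0$ and $\|v_\lambda\eta(a)v_\lambda^*-\theta(a)\|\to 0$. *)

(* Defs.v *)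
From HB Require Import structures.
From mathcomp Require Import all_boot all_order all_algebra complex.
From mathcomp Require Import boolp classical_sets reals topology normedtype.
Set Implicit Arguments.
Unset Strict Implicit.
Unset Printing Implicit Defensive.
Import Order.TTheory GRing.Theory Num.Theory.
Import numFieldNormedType.Exports.
Local Open Scope classical_set_scope.
Local Open Scope complex_scope.
Local Open Scope ring_scope.

(* The multiplication is a new operation because the algebras need not have a
   unit, while the ring structures of the algebraic hierarchy all have one. *)
HB.mixin Record Lmodule_isStarAlgebra (R : realType) A
    of GRing.Lmodule R[i] A := {
  amul : A -> A -> A ;
  star : A -> A ;
  amulA : associative amul ;
  amulDl : left_distributive amul +%R ;
  amulDr : right_distributive amul +%R ;
  amulZl : forall (c : R[i]) (x y : A), amul (c *: x) y = c *: amul x y ;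
  amulZr : forall (c : R[i]) (x y : A), amul x (c *: y) = c *: amul x y ;
  starK : involutive star ;
  starD : {morph star : x y / x + y} ;
  starZ : forall (c : R[i]) (x : A), star (c *: x) = conjc c *: star x ;
  starM : forall x y : A, star (amul x y) = amul (star y) (star x)
}.

#[short(type="starAlgType")]
HB.structure Definition StarAlgebra (R : realType) :=
  {A of GRing.Lmodule R[i] A & Lmodule_isStarAlgebra R A}.

Declare Scope cstar_scope.
Delimit Scope cstar_scope with cstar.
Notation "x ** y" := (amul x y) (at level 40, left associativity) : cstar_scope.
Local Open Scope cstar_scope.

#[short(type="topStarAlgType")]
HB.structure Definition TopStarAlgebra (R : realType) :=
  {A of StarAlgebra R A & Topological A}.

(* The norm of a normed module over R[i] takes its values in R[i]. *)
HB.mixin Record StarAlgebra_isCstar (R : realType) A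
    of StarAlgebra R A & CompleteNormedModule R[i] A := {
  norm_amul : forall x y : A, `|x ** y| <= `|x| * `|y| ;
  norm_star_amul : forall x : A, `|star x ** x| = `|x| ^+ 2
}.

#[short(type="cstarAlgType")]
HB.structure Definition Cstar (R : realType) :=
  {A of StarAlgebra R A & CompleteNormedModule R[i] A
      & StarAlgebra_isCstar R A}.

Definition is_unit_elt (R : realType) (A : starAlgType R) (e : A) : Prop :=
  forall a : A, e ** a = a /\ a ** e = a.

Definition star_hom (R : realType) (A B : starAlgType R) (f : A -> B) : Prop :=
  [/\ linear f, {morph f : x y / x ** y} & {morph f : x / star x}].

(* The alias keeps the module structure below apart from the one 'M[K]_n has
   over its own coefficient ring K. Its topology is that of 'M[A]_n, entrywise
   convergence; for a C*-algebra A this is the norm topology of the C*-algebra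
   M_n(A), whose norm satisfies |x i j| <= |x| <= \sum_(i, j) |x i j|. *)
Definition matalg (n : nat) (A : Type) : Type := 'M[A]_n.

Section MatAlg.
Variables (R : realType) (n : nat).

HB.instance Definition _ (A : topologicalType) :=
  Topological.copy (matalg n A) 'M[A]_n.

Section StarAlg.
Variable A : starAlgType R.

HB.instance Definition _ := GRing.Zmodule.copy (matalg n A) 'M[A]_n.

Definition matalg_scale (c : R[i]) (x : matalg n A) : matalg n A :=
  \matrix_(i, j) (c *: (x : 'M[A]_n) i j).

Definition matalg_mul (x y : matalg n A) : matalg n A :=
  \matrix_(i, j) \sum_k ((x : 'M[A]_n) i k ** (y : 'M[A]_n) k j).

Definition matalg_star (x : matalg n A) : matalg n A :=
  \matrix_(i, j) star ((x : 'M[A]_n) j i).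

Fact matalg_scalerA c d x :
  matalg_scale c (matalg_scale d x) = matalg_scale (c * d) x.
Proof. by apply/matrixP => i j; rewrite !mxE scalerA. Qed.

Fact matalg_scale1r : left_id 1 matalg_scale.
Proof. by move=> x; apply/matrixP => i j; rewrite !mxE scale1r. Qed.

Fact matalg_scalerDr : right_distributive matalg_scale +%R.
Proof. by move=> c x y; apply/matrixP => i j; rewrite !mxE scalerDr. Qed.

Fact matalg_scalerDl x : {morph matalg_scale^~ x : c d / c + d}.
Proof. by move=> c d; apply/matrixP => i j; rewrite !mxE scalerDl. Qed.

HB.instance Definition _ := GRing.Zmodule_isLmodule.Build R[i] (matalg n A)
  matalg_scalerA matalg_scale1r matalg_scalerDr matalg_scalerDl.

Lemma amul0l (x : A) : 0 ** x = 0.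
Proof. by apply: (addrI (0 ** x)); rewrite -amulDl !addr0. Qed.

Lemma amul0r (x : A) : x ** 0 = 0.
Proof. by apply: (addrI (x ** 0)); rewrite -amulDr !addr0. Qed.

Lemma star0 : star (0 : A) = 0.
Proof. by apply: (addrI (star (0 : A))); rewrite -starD !addr0. Qed.

Lemma amul_suml I (r : seq I) (F : I -> A) x :
  (\sum_(i <- r) F i) ** x = \sum_(i <- r) F i ** x.
Proof.
exact: (big_morph (fun y => y ** x) (fun y z => amulDl y z x) (amul0l x)).
Qed.

Lemma amul_sumr I (r : seq I) (F : I -> A) x :
  x ** (\sum_(i <- r) F i) = \sum_(i <- r) x ** F i.
Proof. exact: (big_morph (fun y => x ** y) (amulDr x) (amul0r x)). Qed.

Lemma star_sum I (r : seq I) (F : I -> A) :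
  star (\sum_(i <- r) F i) = \sum_(i <- r) star (F i).
Proof. exact: (big_morph _ starD star0). Qed.

Fact matalg_mulA : associative matalg_mul.
Proof.
move=> x y z; apply/matrixP => i j; rewrite !mxE.
under eq_bigr => k _ do rewrite mxE amul_sumr.
rewrite exchange_big /=; apply: eq_bigr => k _; rewrite mxE amul_suml.
by apply: eq_bigr => l _; rewrite amulA.
Qed.

Fact matalg_mulDl : left_distributive matalg_mul +%R.
Proof.
move=> x y z; apply/matrixP => i j; rewrite !mxE -big_split /=.
by apply: eq_bigr => k _; rewrite mxE amulDl.
Qed.

Fact matalg_mulDr : right_distributive matalg_mul +%R.
Proof.
move=> x y z; apply/matrixP => i j; rewrite !mxE -big_split /=.
by apply: eq_bigr => k _; rewrite mxE amulDr.
Qed.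

Fact matalg_mulZl (c : R[i]) (x y : matalg n A) :
  matalg_mul (c *: x) y = c *: matalg_mul x y.
Proof.
apply/matrixP => i j; rewrite !mxE scaler_sumr.
by apply: eq_bigr => k _; rewrite mxE amulZl.
Qed.

Fact matalg_mulZr (c : R[i]) (x y : matalg n A) :
  matalg_mul x (c *: y) = c *: matalg_mul x y.
Proof.
apply/matrixP => i j; rewrite !mxE scaler_sumr.
by apply: eq_bigr => k _; rewrite mxE amulZr.
Qed.

Fact matalg_starK : involutive matalg_star.
Proof. by move=> x; apply/matrixP => i j; rewrite !mxE starK. Qed.

Fact matalg_starD : {morph matalg_star : x y / x + y}.
Proof. by move=> x y; apply/matrixP => i j; rewrite !mxE starD. Qed.

Fact matalg_starZ (c : R[i]) (x : matalg n A) :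
  matalg_star (c *: x) = conjc c *: matalg_star x.
Proof. by apply/matrixP => i j; rewrite !mxE starZ. Qed.

Fact matalg_starM (x y : matalg n A) :
  matalg_star (matalg_mul x y) = matalg_mul (matalg_star y) (matalg_star x).
Proof.
apply/matrixP => i j; rewrite !mxE star_sum.
by apply: eq_bigr => k _; rewrite !mxE starM.
Qed.

HB.instance Definition _ := Lmodule_isStarAlgebra.Build R (matalg n A)
  matalg_mulA matalg_mulDl matalg_mulDr matalg_mulZl matalg_mulZr
  matalg_starK matalg_starD matalg_starZ matalg_starM.

End StarAlg.

HB.instance Definition _ (A : topStarAlgType R) :=
  StarAlgebra.on (matalg n A).

End MatAlg.

Definition amplification (n : nat) (A B : Type) (f : A -> B)
  (x : matalg n A) : matalg n B := map_mx f (x : 'M[A]_n).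

Definition directed (I : Type) (le : I -> I -> Prop) : Prop :=
  [/\ inhabited I, (forall i, le i i),
      (forall i j k, le i j -> le j k -> le i k) &
      forall i j, exists k, le i k /\ le j k].

Definition tails (I : Type) (le : I -> I -> Prop) : set_system I :=
  [set U | exists i0, forall i, le i0 i -> U i].

Section RealRankZero.
Variable R : realType.

Definition positive (A : starAlgType R) (a : A) : Prop :=
  exists x : A, a = star x ** x.

Definition projection (A : starAlgType R) (p : A) : Prop :=
  star p = p /\ p ** p = p.

Definition Her (B : topStarAlgType R) (b : B) : set B :=
  closure [set b ** x ** b | x in setT].

(* As usual for real rank zero, the net need not be increasing. *)
Definition has_approx_unit_of_projections (B : topStarAlgType R) (H : set B)
    : Prop :=
  exists (I : Type) (le : I -> I -> Prop) (p : I -> B),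
    [/\ directed le,
        (forall i, H (p i) /\ projection (p i)) &
        forall h, H h ->
          (fun i => p i ** h) @ tails le --> h /\
          (fun i => h ** p i) @ tails le --> h].

Definition real_rank_zero (A B : topStarAlgType R) (theta : A -> B) : Prop :=
  forall a : A, positive a -> has_approx_unit_of_projections (Her (theta a)).

Definition approx_MvN_equivalent (A B : cstarAlgType R) (theta eta : A -> B)
    : Prop :=
  exists (I : Type) (le : I -> I -> Prop) (v : I -> B),
    [/\ directed le,
        (forall i, `|v i| <= 1) &
        forall a : A,
          (fun i => star (v i) ** theta a ** v i) @ tails le --> eta a /\
          (fun i => v i ** eta a ** star (v i)) @ tails le --> theta a].

End RealRankZero.

(* Main.v *)
Require Import Defs.
From Stdlib Require Ncring Ncring_tac.
From HB Require Import structures.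
From mathcomp Require Import all_boot all_order all_algebra complex.
From mathcomp Require Import boolp classical_sets reals topology normedtype.
From mathcomp Require Import ring lra.
Set Implicit Arguments.
Unset Strict Implicit.
Unset Printing Implicit Defensive.
Import Order.TTheory GRing.Theory Num.Theory.
Import numFieldNormedType.Exports.
Local Open Scope classical_set_scope.
Local Open Scope ring_scope.

(* Let theta = beta alpha with both maps of real rank zero, e = alpha 1, and let
   b = b^* in M_2(A) have columns b_0, b_1. Cutting the (0,0) entry of b^* b at
   height t and using real rank zero of alpha gives a projection p_0 in C on
   which that entry is at least t and off which it is at most 2t; the range
   projection q_0 of alpha(b_0) p_0 then nearly absorbs alpha(b_0). The
   remaining column (1 - q_0) alpha(b_1) again has its inner square in eCe, so
   real rank zero of beta produces q_1 in M_2(B) for it, orthogonal to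
   beta(q_0), and Q = beta(q_0) + q_1 nearly absorbs theta(b). Moreover
   Q = theta(b) m theta(b) with |m| bounded by a function of |b| and t only.
   This uniform bound lets Q be transported along theta_i -> iota, or along
   v theta v^* -> iota, to nearly idempotent elements iota(b) m' iota(b), which
   z |-> 3 z^2 - 2 z^3 turns into projections of Her(iota(b)). *)

(** * Unital C*-algebras over the real scalars *)

(** Real rank zero controls single elements, whereas a self-adjoint [b] in [M_2(A)] mixes four.
    Working column by column replaces [b] by inner squares of columns, which are positive elements
    of the coefficient algebra. Each column then costs one map of real rank zero: two columns, two
    maps. The projection found for the first column has entries in [C], so what it leaves of the
    second column no longer comes from [A] and is left to [beta]. A projection in [Her(theta(b))]
    does not by itself yield one in [Her(iota(b))], however close the maps are; this is the purpose
    of the coefficient [m]. Replacing the outer factors [theta(b)] by [iota(b)] costs an error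
    proportional to [|m|], and the bound on [|m|] grows as [t] shrinks. Hence [t] is fixed before
    the index moves. Positivity is built from square roots and Neumann series alone, without
    spectra. *)

(* Corners eAe of a C*-algebra, e a projection, are the intended models; e may be
   0, so that the ring may be trivial. The complex scalars are reduced to the
   central reals [sc t] and the imaginary unit [ii]. *)
HB.mixin Record PzRing_isUCstar (R : realType) V of GRing.PzRing V := {
  sc : R -> V ;
  scB : {morph sc : s t / s - t} ;
  scM : {morph sc : s t / s * t} ;
  sc1 : sc 1 = 1 ;
  scC : forall (t : R) (x : V), sc t * x = x * sc t ;
  adj : V -> V ;
  adjK : involutive adj ;
  adjD : {morph adj : x y / x + y} ;
  adjM : forall x y : V, adj (x * y) = adj y * adj x ;
  adj_sc : forall t : R, adj (sc t) = sc t ;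
  ii : V ;
  iiC : forall x : V, ii * x = x * ii ;
  iiM : ii * ii = -1 ;
  adj_ii : adj ii = - ii ;
  nm : V -> R ;
  nm0_eq0 : forall x : V, nm x = 0 -> x = 0 ;
  ler_nmD : forall x y : V, nm (x + y) <= nm x + nm y ;
  nmZ : forall (t : R) (x : V), nm (sc t * x) = `|t| * nm x ;
  nmM : forall x y : V, nm (x * y) <= nm x * nm y ;
  nm_adjM : forall x : V, nm (adj x * x) = nm x ^+ 2 ;
  nm_complete : forall (u : nat -> V) (eta : nat -> R) (K : R),
    (forall n, nm (u n.+1 - u n) <= eta n.+1 - eta n) ->
    (forall n, eta n <= K) ->
    exists l : V, forall eps : R, 0 < eps ->
      exists N : nat, forall n : nat, (N <= n)%N -> nm (u n - l) < eps
}.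

#[short(type="ucstarType")]
HB.structure Definition UCstar (R : realType) :=
  {V of GRing.PzRing V & PzRing_isUCstar R V}.

Section NcRing.
Variable V : pzRingType.

#[local] Instance pzRing_ops : @Ncring.Ring_ops V 0 1 (fun x y => x + y)
  (fun x y => x * y) (fun x y => x - y) (fun x => - x) eq := {}.

#[local] Instance pzRing_Ring : Ncring.Ring (Ro := pzRing_ops).
Proof.
constructor; try exact _; try by move=> *; subst.
- exact: add0r.
- exact: addrC.
- exact: addrA.
- exact: mul1r.
- exact: mulr1.
- exact: mulrA.
- exact: mulrDl.
- by move=> x y z; apply: mulrDr.
- exact: subrr.
Qed.

End NcRing.
#[local] Existing Instances pzRing_ops pzRing_Ring.

Ltac ncring := Ncring_tac.non_commutative_ring.

Section UCstarTheory.
Variables (R : realType) (V : ucstarType R).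
Implicit Types (x y z a b c d l m w : V) (u v : nat -> V) (t : R).

HB.instance Definition _ := GRing.isZmodMorphism.Build R V sc scB.
HB.instance Definition _ :=
  GRing.isMonoidMorphism.Build R V sc (sc1, scM).

Lemma nm0 : nm (0 : V) = 0.
Proof. by rewrite -(mulr0 (sc 0)) nmZ normr0 mul0r. Qed.

Lemma nmN x : nm (- x) = nm x.
Proof. by rewrite -mulN1r -sc1 -rmorphN nmZ normrN1 mul1r. Qed.

Lemma nm_ge0 x : 0 <= nm x.
Proof. have := ler_nmD x (- x); rewrite subrr nm0 nmN; lra. Qed.

Lemma ler_nmB x y : nm (x - y) <= nm x + nm y.
Proof. by rewrite -(nmN y) ler_nmD. Qed.

Lemma nm_le_eps x : (forall eps, 0 < eps -> nm x <= eps) -> x = 0.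
Proof.
move=> h; apply: nm0_eq0; apply/eqP; rewrite eq_le nm_ge0 andbT leNgt.
apply/negP => x0; have := h (nm x / 2); lra.
Qed.

Lemma adj0 : adj (0 : V) = 0.
Proof. by apply: (addrI (adj 0)); rewrite -adjD !addr0. Qed.

Lemma adjN x : adj (- x) = - adj x.
Proof. by apply: (addrI (adj x)); rewrite -adjD !subrr adj0. Qed.

Lemma adjB x y : adj (x - y) = adj x - adj y.
Proof. by rewrite adjD adjN. Qed.

Lemma adj1 : adj (1 : V) = 1.
Proof. by rewrite -[LHS]mulr1 -{2}(adjK 1) -adjM mulr1 adjK. Qed.

(** The C*-identity gives [nm y ^+ 2 <= nm (adj y) * nm y], where a factor [nm y] cancels; [adj]
    being an involution, one inequality suffices. *)
Lemma nm_adj x : nm (adj x) = nm x.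
Proof.
suff le y : nm y <= nm (adj y).
  by apply/eqP; rewrite eq_le le -{2}(adjK x) le.
have [->|y0] := eqVneq (nm y) 0; first exact: nm_ge0.
have {}y0 : 0 < nm y by rewrite lt_def y0 nm_ge0.
by rewrite -(ler_pM2r y0) -expr2 -nm_adjM nmM.
Qed.

(** Only an inequality: in the trivial ring, the corner at the zero projection, [1] has norm 0. *)
Lemma nm1_le1 : nm (1 : V) <= 1.
Proof.
have := nm_adjM (1 : V); rewrite adj1 mulr1 => h.
have := nm_ge0 (1 : V); nra.
Qed.

Lemma nm_sc_le t : 0 <= t -> nm (sc t : V) <= t.
Proof.
by move=> t0; rewrite -[sc t]mulr1 nmZ ger0_norm // ler_piMr // nm1_le1.
Qed.

Definition nlim (u : nat -> V) l := forall eps : R, 0 < eps ->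
  exists N, forall n, (N <= n)%N -> nm (u n - l) < eps.

Lemma nlim_uniq u l l' : nlim u l -> nlim u l' -> l = l'.
Proof.
move=> ul ul'; apply/eqP; rewrite -subr_eq0; apply/eqP/nm_le_eps => e e0.
have [|N hN] := ul (e / 2); first lra.
have [|N' hN'] := ul' (e / 2); first lra.
have h := hN (maxn N N') (leq_maxl _ _).
have h' := hN' (maxn N N') (leq_maxr _ _).
have -> : l - l' = (u (maxn N N') - l') - (u (maxn N N') - l) by ncring.
have := ler_nmB (u (maxn N N') - l') (u (maxn N N') - l); lra.
Qed.

Lemma nlim_cst l : nlim (fun=> l) l.
Proof. by move=> e e0; exists 0%N => n _; rewrite subrr nm0. Qed.

Lemma nlim_shift u l : nlim u l -> nlim (fun n => u n.+1) l.
Proof. by move=> h e /h[N hN]; exists N => n le; apply: hN; apply: leqW. Qed.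

Lemma nlimD u l v m : nlim u l -> nlim v m -> nlim (fun n => u n + v n) (l + m).
Proof.
move=> ul vm e e0.
have [|N hN] := ul (e / 2); first lra.
have [|M hM] := vm (e / 2); first lra.
exists (maxn N M) => n; rewrite geq_max => /andP[/hN hu /hM hv].
have -> : u n + v n - (l + m) = (u n - l) + (v n - m) by ncring.
have := ler_nmD (u n - l) (v n - m); lra.
Qed.

Lemma nlimM u l v m : nlim u l -> nlim v m -> nlim (fun n => u n * v n) (l * m).
Proof.
move=> ul vm e e0.
have l0 := nm_ge0 l; have m0 := nm_ge0 m.
pose d := Num.min 1 (e / (nm l + nm m + 2)).
have d0 : 0 < d by rewrite lt_min ltr01 divr_gt0 //; lra.
have d1 : d <= 1 by rewrite ge_min lexx.
have de : d * (nm l + nm m + 2) <= e.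
  by rewrite -ler_pdivlMr ?ge_min ?lexx ?orbT //; lra.
have [N hN] := ul d d0; have [M hM] := vm d d0.
exists (maxn N M) => n; rewrite geq_max => /andP[/hN hu /hM hv].
have -> : u n * v n - l * m =
  (u n - l) * (v n - m) + ((u n - l) * m + l * (v n - m)) by ncring.
apply: le_lt_trans (ler_nmD _ _) _.
have := ler_nmD ((u n - l) * m) (l * (v n - m)).
have := nmM (u n - l) m; have := nmM l (v n - m).
have := nmM (u n - l) (v n - m).
have := nm_ge0 (u n - l); have := nm_ge0 (v n - m); nra.
Qed.

Lemma nlim_adj u l : nlim u l -> nlim (fun n => adj (u n)) (adj l).
Proof.
by move=> h e /h[N hN]; exists N => n /hN; rewrite -adjB nm_adj.
Qed.

Lemma nlim_nm_le K u l : (forall n, nm (u n) <= K) -> nlim u l -> nm l <= K.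
Proof.
move=> uK ul; rewrite leNgt; apply/negP => lK.
have [|N /(_ N (leqnn N)) hN] := ul (nm l - K); first lra.
have := ler_nmB (u N) (u N - l); have := uK N.
have -> : u N - (u N - l) = l by ncring.
lra.
Qed.

Lemma nlim_comm u l x : nlim u l -> (forall n, GRing.comm x (u n)) ->
  GRing.comm x l.
Proof.
move=> ul h; apply: (@nlim_uniq (fun n => x * u n)).
  exact: nlimM (nlim_cst _) ul.
move=> e e0; have [N hN] := nlimM ul (nlim_cst x) e0.
by exists N => n /hN; rewrite h.
Qed.

Lemma nlim_eq u v l : (forall n, u n = v n) -> nlim u l -> nlim v l.
Proof. by move=> h ul e /ul[N hN]; exists N => n /hN; rewrite h. Qed.

(* [1 - sqrt (1 - x)] is the fixed point of [y |-> (x + y^2) / 2]; the scalar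
   iteration [sqrt_maj] dominates the increments up to [nm x = 1] included. *)
Fixpoint sqrt_iter x n :=
  if n is n'.+1 then sc 2^-1 * (x + sqrt_iter x n' * sqrt_iter x n') else 0.

Fixpoint sqrt_maj n : R :=
  if n is n'.+1 then 2^-1 * (1 + sqrt_maj n' ^+ 2) else 0.

Lemma sqrt_maj_le1 n : 0 <= sqrt_maj n <= 1.
Proof. by elim: n => [|n IH] /=; [lra | nra]. Qed.

Lemma nm_sqrt_iter x n : nm x <= 1 -> nm (sqrt_iter x n) <= sqrt_maj n.
Proof.
move=> x1; elim: n => [|n IH] /=; first by rewrite nm0.
rewrite nmZ ger0_norm ?invr_ge0 // ler_pM2l ?invr_gt0 //.
apply: le_trans (ler_nmD _ _) _; apply: lerD => //.
apply: le_trans (nmM _ _) _; rewrite expr2.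
by apply: ler_pM => //; apply: nm_ge0.
Qed.

(** [y' y' - y y = y' (y' - y) + (y' - y) y], and the scalar recursion obeys the same identity, so
    domination passes from one increment to the next. *)
Lemma sqrt_iter_step x n : nm x <= 1 ->
  nm (sqrt_iter x n.+1 - sqrt_iter x n) <= sqrt_maj n.+1 - sqrt_maj n.
Proof.
move=> x1; elim: n => [|n IH].
  by rewrite subr0 (_ : sqrt_maj 0 = 0) // subr0 nm_sqrt_iter.
have h1 := nm_sqrt_iter n x1; have h2 := nm_sqrt_iter n.+1 x1.
set y := sqrt_iter x n in IH h1 *; set y' := sqrt_iter x n.+1 in IH h2 *.
have -> : sqrt_iter x n.+2 - y' =
    sc 2^-1 * (y' * (y' - y) + (y' - y) * y).
  have -> : sqrt_iter x n.+2 = sc 2^-1 * (x + y' * y') by [].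
  have {3}-> : y' = sc 2^-1 * (x + y * y) by [].
  by rewrite -mulrBr; congr (_ * _); ncring.
have -> : sqrt_maj n.+2 - sqrt_maj n.+1 = 2^-1 *
    ((sqrt_maj n.+1 + sqrt_maj n) * (sqrt_maj n.+1 - sqrt_maj n)).
  by rewrite /=; lra.
rewrite nmZ ger0_norm ?invr_ge0 // ler_pM2l ?invr_gt0 //.
apply: le_trans (ler_nmD _ _) _; rewrite [leRHS]mulrDl.
apply: lerD; apply: le_trans (nmM _ _) _.
  by apply: ler_pM => //; apply: nm_ge0.
by rewrite mulrC; apply: ler_pM => //; apply: nm_ge0.
Qed.

(** The commutation clause does the work of functional calculus: [y] is a limit of polynomials in
    [x], so it commutes with whatever commutes with [x]. *)
Lemma sqrt1B x : adj x = x -> nm x <= 1 ->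
  exists y, [/\ adj y = y, nm y <= 1, (1 - y) * (1 - y) = 1 - x &
    forall z, GRing.comm z x -> GRing.comm z y].
Proof.
move=> xx x1.
have [y hy] : exists y, nlim (sqrt_iter x) y.
  apply: (@nm_complete _ _ _ sqrt_maj 1) => n; first exact: sqrt_iter_step.
  by have /andP[] := sqrt_maj_le1 n.
have y2 : sc 2^-1 * (x + y * y) = y.
  apply: nlim_uniq (nlim_shift hy).
  exact: nlimM (nlim_cst _) (nlimD (nlim_cst x) (nlimM hy hy)).
exists y; split.
- apply: nlim_uniq (nlim_adj hy) _; apply: nlim_eq hy => n.
  by elim: n => [|n IH] /=; rewrite ?adj0 // adjM adj_sc -scC adjD adjM -IH xx.
- apply: nlim_nm_le hy => n; apply: le_trans (nm_sqrt_iter n x1) _.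
  by have /andP[] := sqrt_maj_le1 n.
- have y2' : x + y * y = y + y.
    have h : 2^-1 + 2^-1 = 1 :> R by lra.
    by rewrite -[in RHS]y2 -mulrDl -rmorphD h rmorph1 mul1r.
  have -> : (1 - y) * (1 - y) = (x + y * y) - (y + y) + (1 - x) by ncring.
  by rewrite y2' subrr add0r.
- move=> z zx; apply: nlim_comm hy _; elim=> [|n IH] /=; first exact: commr0.
  have h : GRing.comm z (x + sqrt_iter x n * sqrt_iter x n).
    by apply: commrD => //; apply: commrM.
  by apply: commrM => //; rewrite /GRing.comm scC.
Qed.

End UCstarTheory.

(** * Positive elements *)

Section Positive.
Variables (R : realType) (V : ucstarType R).
Implicit Types (x y z a b c d l m w : V) (t r : R).

(** Positivity without spectra: for self-adjoint [a] the bound confines the spectrum to [[0, 2 t]].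
    Sums are then immediate, since the witnesses add. *)
Definition pos a := adj a = a /\ exists t, nm (sc t - a) <= t.

Lemma scKl t x : t != 0 -> sc t * (sc t^-1 * x) = x.
Proof. by move=> t0; rewrite mulrA -rmorphM divff // rmorph1 mul1r. Qed.

Lemma scCA t x y : x * (sc t * y) = sc t * (x * y).
Proof. by rewrite mulrA -scC -mulrA. Qed.

Lemma pos_scB r a : adj a = a -> nm a <= r -> pos (sc r - a).
Proof.
move=> aa ar; split; first by rewrite adjB adj_sc aa.
by exists r; rewrite opprB addrC subrK.
Qed.

Lemma pos_sc t : 0 <= t -> pos (sc t).
Proof. by move=> t0; split; [exact: adj_sc|exists t; rewrite subrr nm0]. Qed.

Lemma pos0 : pos 0.
Proof. by rewrite -(rmorph0 sc); apply: pos_sc. Qed.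

Lemma posD a b : pos a -> pos b -> pos (a + b).
Proof.
move=> [aa [s ha]] [bb [t hb]]; split; first by rewrite adjD aa bb.
exists (s + t); rewrite rmorphD opprD addrACA.
by apply: le_trans (ler_nmD _ _) _; apply: lerD.
Qed.

Lemma nm_herm_sqr y : adj y = y -> nm (y * y) = nm y ^+ 2.
Proof. by move=> yy; rewrite -nm_adjM yy. Qed.

Lemma pos_sqrt a : pos a ->
  exists s, [/\ pos s, s * s = a & forall z, GRing.comm z a -> GRing.comm z s].
Proof.
move=> [aa [t at_]].
(* Norms are nonnegative, so [t <= 0] forces [t = 0] and [a = 0]. Otherwise [a = t (1 - x)] with
   [nm x <= 1], and the root of [1 - x] is rescaled. *)
have [t0|t0] := leP t 0.
  have -> : a = 0.
    apply: nm_le_eps => e e0; have := ler_nmB (sc t) (sc t - a).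
    rewrite opprB addrC subrK => h; apply: le_trans h _.
    have -> : t = 0 by apply/eqP; rewrite eq_le t0 (le_trans (nm_ge0 _) at_).
    rewrite rmorph0 nm0; have := at_; have := nm_ge0 (sc t - a).
    have -> : t = 0 by apply/eqP; rewrite eq_le t0 (le_trans (nm_ge0 _) at_).
    rewrite rmorph0; lra.
  by exists 0; split; [exact: pos0|rewrite mul0r|move=> z _; exact: commr0].
pose x := 1 - sc t^-1 * a.
have xx : adj x = x by rewrite adjB adj1 adjM adj_sc aa -scC.
have x1 : nm x <= 1.
  have -> : x = sc t^-1 * (sc t - a).
    by rewrite mulrBr -rmorphM mulVf ?gt_eqF // rmorph1.
  by rewrite nmZ gtr0_norm ?invr_gt0 // mulrC ler_pdivrMr // mul1r.
have [y [yy y1 y2 yC]] := sqrt1B xx x1.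
have st0 : 0 <= Num.sqrt t := sqrtr_ge0 t.
exists (sc (Num.sqrt t) * (1 - y)); split.
- split; first by rewrite adjM adj_sc adjB adj1 yy scC.
  exists (Num.sqrt t).
  have -> : sc (Num.sqrt t) - sc (Num.sqrt t) * (1 - y) = sc (Num.sqrt t) * y.
    by ncring.
  by rewrite nmZ ger0_norm // ler_piMr.
- have -> : sc (Num.sqrt t) * (1 - y) * (sc (Num.sqrt t) * (1 - y)) =
      sc (Num.sqrt t) * (sc (Num.sqrt t) * ((1 - y) * (1 - y))).
    by rewrite -!mulrA scCA.
  rewrite y2 mulrA -rmorphM -expr2 sqr_sqrtr ?ltW // opprB addrC subrK.
  by rewrite scKl // gt_eqF.
- move=> z za; apply: commrM; first by rewrite /GRing.comm scC.
  apply: commrB; first exact: commr1.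
  apply: yC; apply: commrB; first exact: commr1.
  by apply: commrM => //; rewrite /GRing.comm scC.
Qed.

(* [y + i w] is [sqrt r] times a unitary with real part [y]. *)
Lemma nm_sqr_le_of_sum y w r : adj y = y -> adj w = w -> GRing.comm y w ->
  0 <= r -> y * y + w * w = sc r -> nm y ^+ 2 <= r.
Proof.
move=> yy ww yw r0 h.
have e1 : y * (ii * w) = ii * (y * w) by rewrite mulrA -iiC -mulrA.
have e2 : w * (ii * w) = ii * (w * w) by rewrite mulrA -iiC -mulrA.
pose z := y + ii * w.
have adjz : adj z = y - ii * w by rewrite adjD adjM adj_ii yy ww mulrN iiC.
have zz : adj z * z = sc r.
  have -> : adj z * z =
      y * y + y * (ii * w) - ii * (w * y) - ii * (w * (ii * w)).
    by rewrite adjz /z; ncring.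
  by rewrite e1 e2 -yw [ii * (ii * _)]mulrA iiM mulN1r opprK addrK.
have z2 : nm z ^+ 2 <= r by rewrite -nm_adjM zz nm_sc_le.
have -> : y = sc 2^-1 * (z + adj z).
  have -> : z + adj z = y + y by rewrite adjz /z; ncring.
  have h2 : 2^-1 + 2^-1 = 1 :> R by lra.
  by rewrite mulrDr -mulrDl -rmorphD h2 rmorph1 mul1r.
apply: le_trans z2; rewrite lerXn2r ?nnegrE ?nm_ge0 //.
rewrite nmZ ger0_norm ?invr_ge0 //.
by have := ler_nmD z (adj z); rewrite nm_adj; lra.
Qed.

(** The root [w] of [r - y^2] commutes with [y] and [w^2 + y^2 = r], so [nm_sqr_le_of_sum] bounds
    [nm w ^+ 2], which is the norm in question. *)
Lemma nm_scB_sqr r y : adj y = y -> nm y ^+ 2 <= r -> nm (sc r - y * y) <= r.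
Proof.
move=> yy yr; have [r0|r0] := leP r 0.
  have -> : y = 0.
    apply: nm0_eq0; have := nm_ge0 y; have := sqr_ge0 (nm y).
    move=> h1 h2; apply/eqP; rewrite -sqrf_eq0 eq_le h1 andbT; lra.
  rewrite mul0r subr0; suff -> : r = 0 by rewrite rmorph0 nm0.
  by have := sqr_ge0 (nm y); lra.
pose x := sc r^-1 * (y * y).
have xx : adj x = x by rewrite !adjM adj_sc yy -scC.
have x1 : nm x <= 1.
  by rewrite nmZ gtr0_norm ?invr_gt0 // nm_herm_sqr // mulrC ler_pdivrMr ?mul1r.
have [v [vv _ v2 vC]] := sqrt1B xx x1.
pose w := sc (Num.sqrt r) * (1 - v).
have ww : adj w = w by rewrite adjM adj_sc adjB adj1 vv -scC.
have w2 : w * w = sc r - y * y.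
  have -> : w * w = sc (Num.sqrt r) * (sc (Num.sqrt r) * ((1 - v) * (1 - v))).
    by rewrite /w -!mulrA scCA.
  rewrite v2 mulrA -rmorphM -expr2 sqr_sqrtr ?ltW // mulrBr mulr1.
  by rewrite scKl // gt_eqF.
have wy : GRing.comm w y.
  apply/commr_sym/commrM; first by rewrite /GRing.comm scC.
  apply: commrB; first exact: commr1.
  apply: vC; apply: commrM; first by rewrite /GRing.comm scC.
  exact: commrM.
rewrite -w2 nm_herm_sqr //; apply: nm_sqr_le_of_sum wy (ltW r0) _ => //.
by rewrite w2 subrK.
Qed.

Lemma pos_sqr y : adj y = y -> pos (y * y).
Proof.
move=> yy; split; first by rewrite adjM yy.
by exists (nm y ^+ 2); apply: nm_scB_sqr.
Qed.

(** Frees the witness in [pos]: any bound of the norm will do. *)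
Lemma pos_nm r a : pos a -> nm a <= r -> nm (sc r - a) <= r.
Proof.
move=> /pos_sqrt[s [[ss _] <- _]]; rewrite nm_herm_sqr //.
exact: nm_scB_sqr.
Qed.

(** The roots of [a] and [sc r - a] commute and their squares add up to [sc r]. This is how order
    bounds become norm bounds. *)
Lemma pos_nm_le r a : 0 <= r -> pos a -> pos (sc r - a) -> nm a <= r.
Proof.
move=> r0 /pos_sqrt[y [[yy _] ya _]] /pos_sqrt[w [[ww _] wa wC]].
rewrite -ya nm_herm_sqr //; apply: (nm_sqr_le_of_sum yy ww _ r0).
  apply: wC; apply: commrB; first by rewrite /GRing.comm scC.
  by rewrite /GRing.comm -ya mulrA.
by rewrite ya wa addrC subrK.
Qed.

Lemma pos_mono a b : pos a -> pos (b - a) -> nm a <= nm b.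
Proof.
move=> pa pba; apply: (pos_nm_le (nm_ge0 b) pa).
have bb : adj b = b.
  by have [] := posD pba pa; rewrite subrK.
have -> : sc (nm b) - a = (sc (nm b) - b) + (b - a) by ncring.
by apply: posD pba; apply: pos_scB.
Qed.

(** Two uses of the commutation clause of [pos_sqrt] make the roots commute, so [a b] is the square
    of the self-adjoint [s w]. *)
Lemma posM a b : pos a -> pos b -> GRing.comm a b -> pos (a * b).
Proof.
move=> /pos_sqrt[s [[ss _] sa sC]] /pos_sqrt[w [[ww _] wb wC]] ab.
have sw : GRing.comm s w by apply: wC; apply/commr_sym/sC/commr_sym.
have -> : a * b = s * w * (s * w).
  by rewrite -sa -wb -!mulrA; congr (_ * _); rewrite !mulrA sw.
by apply: pos_sqr; rewrite adjM ss ww sw.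
Qed.

Fixpoint neumann_iter x n :=
  if n is n'.+1 then 1 + x * neumann_iter x n' else 0.

Fixpoint neumann_maj r n : R :=
  if n is n'.+1 then 1 + r * neumann_maj r n' else 0.

Lemma neumann x r : nm x <= r -> r < 1 -> exists v,
  [/\ v * (1 - x) = 1, (1 - x) * v = 1 & nm v <= (1 - r)^-1].
Proof.
move=> xr r1; have r0 : 0 <= r := le_trans (nm_ge0 x) xr.
(* [(1 - r)^-1] is the fixed point of the monotone recursion [s |-> 1 + r s], which starts below
   it. *)
have maj n : neumann_maj r n <= (1 - r)^-1.
  rewrite -[leRHS]mul1r ler_pdivlMr ?subr_gt0 //.
  by elim: n => [|n IH] /=; [lra|nra].
have le_maj n : nm (neumann_iter x n) <= neumann_maj r n.
  elim: n => [|n IH] /=; first by rewrite nm0.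
  apply: le_trans (ler_nmD _ _) _; apply: lerD; first exact: nm1_le1.
  by apply: le_trans (nmM _ _) _; apply: ler_pM => //; apply: nm_ge0.
have [v hv] : exists v, nlim (neumann_iter x) v.
  apply: (@nm_complete _ _ _ (neumann_maj r) (1 - r)^-1) => // n.
  elim: n => [|n IH]; first by rewrite /= !mulr0 !subr0 !addr0 nm1_le1.
  have -> : neumann_iter x n.+2 - neumann_iter x n.+1 =
      x * (neumann_iter x n.+1 - neumann_iter x n) by rewrite /=; ncring.
  have -> : neumann_maj r n.+2 - neumann_maj r n.+1 =
      r * (neumann_maj r n.+1 - neumann_maj r n) by rewrite /=; ring.
  by apply: le_trans (nmM _ _) _; apply: ler_pM => //; apply: nm_ge0.
have v1 : 1 + x * v = v.
  apply: nlim_uniq (nlim_shift hv).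
  exact: nlimD (nlim_cst _) (nlimM (nlim_cst _) hv).
have xv : GRing.comm x v.
  apply: nlim_comm hv _; elim=> [|n IH] /=; first exact: commr0.
  by apply: commrD; [exact: commr1|exact: commrM].
have v2 : (1 - x) * v = 1.
  by rewrite mulrBl mul1r -{1}v1 addrK.
exists v; split=> //; last first.
  by apply: nlim_nm_le hv => n; apply: le_trans (le_maj n) (maj n).
by rewrite mulrBr mulr1 -xv -{1}v1 addrK.
Qed.

Lemma adj_inv v b : adj b = b -> v * b = 1 -> b * v = 1 -> adj v = v.
Proof.
move=> bb vb bv; have h : adj v * b = 1 by rewrite -bb -adjM bv adj1.
by rewrite -[LHS]mulr1 -bv mulrA h mul1r.
Qed.

Lemma pos_inv v b : pos b -> v * b = 1 -> b * v = 1 -> pos v.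
Proof.
move=> pb vb bv; have vv : adj v = v by apply: adj_inv (vb) (bv); have [] := pb.
have -> : v = v * v * b by rewrite -mulrA vb mulr1.
apply: posM => //; first exact: pos_sqr.
by rewrite /GRing.comm -mulrA vb mulr1 mulrA bv mul1r.
Qed.

(** With [r = nm a], [t + a = (t + r) (1 - x)] where [nm x <= r / (t + r) < 1], because
    [nm (sc r - a) <= r]. The Neumann bound then comes out as exactly [1 / t]. *)
Lemma pos_resolvent t a : 0 < t -> pos a -> exists v,
  [/\ pos v, v * (sc t + a) = 1, (sc t + a) * v = 1 & nm v <= t^-1].
Proof.
move=> t0 pa; pose r := nm a.
have r0 : 0 <= r := nm_ge0 a.
have tr0 : 0 < t + r by lra.
have ar := pos_nm pa (lexx r).
pose x := sc (t + r)^-1 * (sc r - a).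
have [||v [v1 v2 vn]] := @neumann x (r / (t + r)).
- by rewrite nmZ gtr0_norm ?invr_gt0 // mulrC ler_pM2r ?invr_gt0.
- by rewrite ltr_pdivrMr // mul1r; lra.
have tax : sc t + a = sc (t + r) * (1 - x).
  by rewrite mulrBr mulr1 scKl ?gt_eqF // rmorphD; ncring.
pose v' := sc (t + r)^-1 * v.
have h1 : v' * (sc t + a) = 1.
  rewrite tax /v' -mulrA scCA v1 mulr1.
  by rewrite -rmorphM mulVf ?gt_eqF // rmorph1.
have h2 : (sc t + a) * v' = 1.
  rewrite tax /v' -mulrA scCA v2 mulr1.
  by rewrite -rmorphM divff ?gt_eqF // rmorph1.
exists v'; split => //.
  by apply: (pos_inv _ h1 h2); apply: posD pa; apply/pos_sc/ltW.
rewrite nmZ gtr0_norm ?invr_gt0 // -ler_pdivlMl ?invr_gt0 // invrK.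
apply: le_trans vn _; rewrite -[leLHS]mul1r ler_pdivrMr ?subr_gt0; last first.
  by rewrite ltr_pdivrMr // mul1r; lra.
have -> : (t + r) * t^-1 * (1 - r / (t + r)) = 1 by field; rewrite !gt_eqF.
by [].
Qed.

(** [g] and [k] are, up to sign, twice the real and imaginary parts of [y]; the sum is half of
    [g^2 + k^2]. *)
Lemma pos_adjM_addC y : pos (adj y * y + y * adj y).
Proof.
pose k := ii * (y - adj y); pose g := y + adj y.
have kk : adj k = k.
  by rewrite /k adjM adjB adjK adj_ii mulrN -iiC -mulrN opprB.
have gg : adj g = g by rewrite /g adjD adjK addrC.
have -> : adj y * y + y * adj y = sc 2^-1 * (g * g + k * k).
  have -> : k * k = - ((y - adj y) * (y - adj y)).
    rewrite /k -mulrA [(y - _) * (ii * _)]mulrA -iiC -mulrA mulrA iiM.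
    by rewrite mulN1r.
  have -> : g * g - (y - adj y) * (y - adj y) =
      (adj y * y + y * adj y) + (adj y * y + y * adj y) by rewrite /g; ncring.
  have h2 : 2^-1 + 2^-1 = 1 :> R by lra.
  by rewrite mulrDr -mulrDl -rmorphD h2 rmorph1 mul1r.
apply: posM; first by apply: pos_sc; lra.
  by apply: posD; apply: pos_sqr.
by rewrite /GRing.comm scC.
Qed.

(* Otherwise [t := nm c > 0] and [sc t - c] is positive and invertible, hence
   bounded below, so that [nm c < t]. *)
Lemma pos_opp_adjM y : pos (- (adj y * y)) -> y = 0.
Proof.
set c := - _ => pc.
suff c0 : c = 0.
  apply/nm0_eq0/eqP; rewrite -sqrf_eq0 -nm_adjM -[adj y * y]opprK -/c c0.
  by rewrite oppr0 nm0.
have pyy : pos (y * adj y).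
  have -> : y * adj y = (adj y * y + y * adj y) + c by rewrite /c; ncring.
  exact: (posD (pos_adjM_addC y) pc).
apply/nm0_eq0/eqP; apply/negPn/negP => cn0.
set t := nm c in cn0.
have t0 : 0 < t by rewrite lt_def cn0 nm_ge0.
have [v [_ v1 v2 _]] := pos_resolvent t0 pyy.
pose d := sc t - c.
have pd : pos d by apply: pos_scB => //; have [] := pc.
(* Of the two products only [y y^*] is known to be positive here. Its resolvent [v] is exchanged for
   an inverse of [d = t + y^* y]. *)
pose w := sc t^-1 * (1 - adj y * v * y).
have dE : d = sc t + adj y * y by rewrite /d /c opprK.
have tE x : sc t^-1 * (sc t * x) = x.
  by rewrite mulrA -rmorphM mulVf ?gt_eqF // rmorph1 mul1r.
have wd : w * d = 1.
  rewrite /w -mulrA.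
  have -> : (1 - adj y * v * y) * d =
      sc t + adj y * y - adj y * (v * (y * sc t + y * adj y * y)).
    by rewrite dE; ncring.
  have -> : y * sc t + y * adj y * y = (sc t + y * adj y) * y.
    by rewrite mulrDl scC.
  by rewrite [v * _]mulrA v1 mul1r addrK -[sc t]mulr1 tE.
have dw : d * w = 1.
  rewrite /w scCA.
  have -> : d * (1 - adj y * v * y) =
      sc t + adj y * y - (sc t * adj y + adj y * (y * adj y)) * v * y.
    by rewrite dE; ncring.
  have -> : sc t * adj y + adj y * (y * adj y) = adj y * (sc t + y * adj y).
    by rewrite mulrDr scC.
  by rewrite -[adj y * _ * v]mulrA v2 mulr1 addrK -[sc t]mulr1 tE.
have pw := pos_inv pd wd dw.
have [M0|M0] := leP (nm w) 0.
  have w0 : w = 0 by apply/nm0_eq0/eqP; rewrite eq_le M0 nm_ge0.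
  move: cn0; rewrite /t -[c]mulr1 -wd w0 mul0r mulr0 nm0 eqxx //.
set M := nm w in M0.
(* [w <= M] multiplied by [d] reads [1 <= M d], that is [c <= t - 1/M], against [nm c = t]. *)
have : pos ((sc M - w) * d).
  apply: posM => //; first by apply: pos_scB => //; have [] := pw.
  by rewrite /GRing.comm [LHS]mulrBl (mulrBr d) wd dw scC.
rewrite mulrBl wd => /(posM (@pos_sc M^-1 _)) h.
have : pos (sc (t - M^-1) - c).
  have -> : sc (t - M^-1) - c = sc M^-1 * (sc M * d - 1).
    rewrite mulrBr mulrA -rmorphM mulVf ?gt_eqF // rmorph1 mul1r mulr1.
    by rewrite rmorphB /d; ncring.
  apply: h; first by rewrite invr_ge0 ltW.
  by rewrite /GRing.comm scC.
have Mi : 0 < M^-1 by rewrite invr_gt0.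
have [tM|tM] := leP 0 (t - M^-1).
  by move=> /(pos_nm_le tM pc); rewrite -/t; lra.
move=> /posD /(_ (@pos_sc (M^-1 - t) _)) {}h.
have : pos (sc 0 - c).
  have -> : sc 0 - c = sc (t - M^-1) - c + sc (M^-1 - t).
    by rewrite !rmorphB rmorph0; ncring.
  by apply: h; lra.
by move=> /(pos_nm_le (lexx 0) pc); rewrite -/t; lra.
Qed.

(** [s] is the absolute value of [b] and [n] twice its negative part. The inner square of [x n] is
    [n b n = - n^2 s], so [pos_opp_adjM] gives [x n = 0]; hence [n = 0] and [b = s]. *)
Lemma pos_adjM x : pos (adj x * x).
Proof.
set b := adj x * x; have bb : adj b = b by rewrite adjM adjK.
have [s [ps s2 sC]] := pos_sqrt (pos_sqr bb).
have bs : GRing.comm b s by apply: sC; rewrite /GRing.comm mulrA.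
have [ss _] := ps; pose n := s - b.
have nn : adj n = n by rewrite adjB ss bb.
have nb : n * b = - (n * s).
  rewrite -[RHS]add0r; apply/eqP; rewrite eq_sym subr_eq eq_sym; apply/eqP.
  have -> : n * b + n * s = s * s - b * b - (b * s - s * b).
    by rewrite /n; ncring.
  by rewrite s2 bs !subrr.
have ns : GRing.comm n s.
  by apply/commr_sym/commrB => //; apply: commr_sym.
have xn : x * n = 0.
  apply: pos_opp_adjM.
  have -> : - (adj (x * n) * (x * n)) = n * n * s.
    rewrite adjM nn; have -> : n * adj x * (x * n) = n * (b * n).
      by rewrite /b !mulrA.
    have -> : b * n = n * b by rewrite /n mulrBr mulrBl bs.
    by rewrite nb mulrN opprK mulrA.
  apply: posM ps _ => //; first exact: pos_sqr.
  by apply/commr_sym/commrM; apply: commr_sym.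
have bn : b * n = 0 by rewrite /b -mulrA xn mulr0.
have nb0 : n * b = 0 by rewrite -[LHS]adjK adjM bb nn bn adj0.
have ns0 : n * s = 0 by rewrite -[LHS]opprK -nb nb0 oppr0.
have n2 : n * n = 0 by rewrite {2}/n mulrBr ns0 nb0 subrr.
have n0 : n = 0.
  apply/nm0_eq0/eqP; rewrite -sqrf_eq0 -nm_herm_sqr // n2 nm0 //.
by rewrite -[b](subKr s) -/n n0 subr0.
Qed.

Lemma pos_conj b x : pos b -> pos (adj x * b * x).
Proof.
move=> /pos_sqrt[s [[ss _] <- _]].
have -> : adj x * (s * s) * x = adj (s * x) * (s * x) by rewrite adjM ss !mulrA.
exact: pos_adjM.
Qed.

(* [m] and [n] are twice the positive and negative parts of [s - sc t]. *)
Lemma herm_cut s t : adj s = s -> exists m n g : V,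
  [/\ adj m = m, n * m = 0, pos g, s - sc t = m - g & s - sc t + n = g].
Proof.
move=> ss; pose d := s - sc t.
have dd : adj d = d by rewrite adjB adj_sc ss.
have [g [pg g2 gC]] := pos_sqrt (pos_sqr dd).
have dg : GRing.comm d g by apply: gC; rewrite /GRing.comm mulrA.
exists (g + d), (g - d), g; split=> //.
- by have [gg _] := pg; rewrite adjD gg dd.
- have -> : (g - d) * (g + d) = g * g - d * d + (g * d - d * g) by ncring.
  by rewrite g2 dg !subrr addr0.
- by rewrite -/d addrC addKr.
- by rewrite -/d; ncring.
Qed.

End Positive.

(** * Projections cut out by maps of real rank zero *)

Section Projections.
Variables (R : realType) (V : ucstarType R).
Implicit Types (x y p : V).

Lemma nm_proj p : adj p = p -> p * p = p -> nm p <= 1.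
Proof.
move=> pp p2; have := nm_herm_sqr pp; rewrite p2 => h.
by have := nm_ge0 p; nra.
Qed.

Lemma proj_compl p : p * p = p -> (1 - p) * (1 - p) = 1 - p.
Proof.
move=> p2; have -> : (1 - p) * (1 - p) = 1 - p - (p - p * p) by ncring.
by rewrite p2 subrr subr0.
Qed.

End Projections.

Section RealRankZeroMaps.
Variables (R : realType) (V W : ucstarType R) (phi : {rmorphism V -> W}).
Hypotheses (phi_adj : {morph phi : x / adj x}).
Hypotheses (phi_sc : forall t, phi (sc t) = sc t).

Lemma pos_morph a : pos a -> pos (phi a).
Proof.
move=> /pos_sqrt[s [[ss _] <- _]]; rewrite rmorphM.
by apply: pos_sqr; rewrite -phi_adj ss.
Qed.

(** The C*-identity reduces this to [a = x^* x], and [phi] preserves the order relation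
    [a <= nm a]. *)
Lemma nm_morph x : nm (phi x) <= nm x.
Proof.
rewrite -(@ler_pXn2r _ 2) ?nnegrE ?nm_ge0 // -!nm_adjM.
rewrite -phi_adj -rmorphM; set a := adj x * x.
have pa : pos a by apply: pos_adjM.
apply: pos_nm_le (nm_ge0 _) (pos_morph pa) _.
rewrite -phi_sc -rmorphB; apply: pos_morph; apply: pos_scB => //.
by have [] := pa.
Qed.

(* The range of [p] lies in the hereditary subalgebra generated by [phi m]. *)
Definition cuts := forall m : V, adj m = m -> forall e : R, 0 < e ->
  exists p : W, [/\ adj p = p, p * p = p, nm ((1 - p) * phi m) <= e &
    forall n, n * m = 0 -> phi n * p = 0].

(** [p] is the cut at [m], twice the positive part of [s - t]. As [phi n] kills [p], compressing
    [phi s] to [p] gives [t p + p (phi g) p], with inverse [r] of norm at most [1 / t]. On [1 - p],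
    use [s = t + m - g <= t + m], where [phi m] contributes at most [t]. *)
Lemma cut_proj s t : cuts -> pos s -> 0 < t -> exists p r : W,
  [/\ adj p = p, p * p = p, pos r, nm r <= t^-1 &
   [/\ r * p = r, r * phi s * p = p &
      nm ((1 - p) * phi s * (1 - p)) <= t + t]].
Proof.
move=> phi_rr0 ps t0; have [ss _] := ps.
have [m [n [g [mm nm0' pg smg sng]]]] := herm_cut t ss.
have [p [pp p2 pm pn]] := phi_rr0 m mm t t0.
have {pn} pn := pn n nm0'.
have pphig := pos_morph pg.
have pgp : pos (p * phi g * p) by rewrite -{1}pp; apply: pos_conj.
have [v [pv v1 v2 vn]] := pos_resolvent t0 pgp.
have vp : GRing.comm v p.
  set b := sc t + _ in v1 v2.
  have bp : p * b = b * p by rewrite /b mulrDl mulrDr -scC -!mulrA p2 !mulrA p2.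
  rewrite /GRing.comm -[LHS]mulr1 -v2.
  have -> : v * p * (b * v) = v * (p * b) * v by rewrite !mulrA.
  by rewrite bp mulrA v1 mul1r.
exists p, (v * p); split=> //.
- by apply: posM => //; rewrite -p2 -{1}pp; apply: pos_adjM.
- apply: le_trans (nmM _ _) _; rewrite -[leRHS]mulr1.
  by apply: ler_pM => //; rewrite ?nm_ge0 ?nm_proj.
split.
- by rewrite -mulrA p2.
- have -> : phi s = sc t + phi g - phi n.
    by rewrite -sng rmorphD rmorphB phi_sc; ncring.
  have -> : v * p * (sc t + phi g - phi n) * p =
      v * (p * sc t * p + p * phi g * p) - v * p * (phi n * p) by ncring.
  rewrite pn mulr0 subr0.
  have -> : p * sc t * p + p * phi g * p = (sc t + p * phi g * p) * p.
    by rewrite mulrDl -scC -!mulrA !p2.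
  by rewrite mulrA v1 mul1r.
have cc : adj (1 - p) = 1 - p by rewrite adjB adj1 pp.
have c2 := proj_compl p2.
have c1 := nm_proj cc c2.
set c := 1 - p in pm cc c2 c1 *.
apply: (@le_trans _ _ (nm (sc t * c + c * phi m * c))).
  apply: pos_mono; first by rewrite -{1}cc; apply: pos_conj; apply: pos_morph.
  have -> : sc t * c + c * phi m * c - c * phi s * c = c * phi g * c.
    have -> : phi s = sc t + phi m - phi g.
      by rewrite -addrA -!rmorphB -smg rmorphB phi_sc addrC subrK.
    rewrite -{1}c2 -scCA; ncring.
  by rewrite -{1}cc; apply: pos_conj.
apply: le_trans (ler_nmD _ _) _; apply: lerD.
  by rewrite nmZ gtr0_norm // ler_piMr // ltW.
apply: le_trans (nmM _ _) _; rewrite -[leRHS]mulr1.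
by apply: ler_pM; rewrite ?nm_ge0.
Qed.

End RealRankZeroMaps.

(** * Matrices over a unital C*-algebra *)

Section MatrixAdjoint.
Variables (R : realType) (V : ucstarType R).

Definition madj m n (A : 'M[V]_(m, n)) : 'M[V]_(n, m) :=
  (map_mx (@adj R V) A)^T.

Lemma madjK m n (A : 'M[V]_(m, n)) : madj (madj A) = A.
Proof. by apply/matrixP => i j; rewrite !mxE adjK. Qed.

Lemma madjD m n (A B : 'M[V]_(m, n)) : madj (A + B) = madj A + madj B.
Proof. by apply/matrixP => i j; rewrite !mxE adjD. Qed.

Lemma madjB m n (A B : 'M[V]_(m, n)) : madj (A - B) = madj A - madj B.
Proof. by apply/matrixP => i j; rewrite !mxE adjB. Qed.

Lemma adj_sum I (r : seq I) (F : I -> V) :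
  adj (\sum_(i <- r) F i) = \sum_(i <- r) adj (F i).
Proof. exact: (big_morph _ (@adjD R V) (@adj0 R V)). Qed.

Lemma madjM m n k (A : 'M[V]_(m, n)) (B : 'M[V]_(n, k)) :
  madj (A *m B) = madj B *m madj A.
Proof.
apply/matrixP => i j; rewrite !mxE adj_sum.
by apply: eq_bigr => l _; rewrite !mxE adjM.
Qed.

Lemma madj_scalar n (a : V) : madj (a%:M : 'M_n) = (adj a)%:M.
Proof.
apply/matrixP => i j; rewrite !mxE eq_sym.
by case: (i == j); rewrite // adj0.
Qed.

(** Stands in for the operator norm, to which it is equivalent: it is submultiplicative across
    rectangular shapes and invariant under [madj], and matrices need no C*-structure of their
    own. *)
Definition mnm m n (A : 'M[V]_(m, n)) : R := \sum_i \sum_j nm (A i j).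

Lemma mnm_ge0 m n (A : 'M[V]_(m, n)) : 0 <= mnm A.
Proof. by apply: sumr_ge0 => i _; apply: sumr_ge0 => j _; apply: nm_ge0. Qed.

Lemma nm_le_mnm m n (A : 'M[V]_(m, n)) i j : nm (A i j) <= mnm A.
Proof.
rewrite /mnm (bigD1 i) //= (bigD1 j) //= -addrA lerDl addr_ge0 //.
  by apply: sumr_ge0 => k _; apply: nm_ge0.
by apply: sumr_ge0 => k _; apply: sumr_ge0 => l _; apply: nm_ge0.
Qed.

Lemma mnmD m n (A B : 'M[V]_(m, n)) : mnm (A + B) <= mnm A + mnm B.
Proof.
rewrite /mnm -big_split /=; apply: ler_sum => i _.
by rewrite -big_split /=; apply: ler_sum => j _; rewrite mxE ler_nmD.
Qed.

Lemma mnmN m n (A : 'M[V]_(m, n)) : mnm (- A) = mnm A.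
Proof. by apply: eq_bigr => i _; apply: eq_bigr => j _; rewrite mxE nmN. Qed.

Lemma mnmB m n (A B : 'M[V]_(m, n)) : mnm (A - B) <= mnm A + mnm B.
Proof. by rewrite -(mnmN B) mnmD. Qed.

Lemma nm_sum I (r : seq I) (F : I -> V) :
  nm (\sum_(i <- r) F i) <= \sum_(i <- r) nm (F i).
Proof.
apply: (big_ind2 (fun x y => nm x <= y)) => //; first by rewrite nm0.
by move=> x a y b xa yb; apply: le_trans (ler_nmD _ _) _; apply: lerD.
Qed.

Lemma mnmM m n k (A : 'M[V]_(m, n)) (B : 'M[V]_(n, k)) :
  mnm (A *m B) <= mnm A * mnm B.
Proof.
apply: (@le_trans _ _ (\sum_i \sum_j \sum_l nm (A i l) * nm (B l j))).
  apply: ler_sum => i _; apply: ler_sum => j _; rewrite mxE.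
  by apply: le_trans (nm_sum _ _) _; apply: ler_sum => l _; apply: nmM.
rewrite /mnm mulr_suml; apply: ler_sum => i _.
rewrite exchange_big mulr_suml; apply: ler_sum => l _ /=.
rewrite -mulr_sumr; apply: ler_wpM2l; first exact: nm_ge0.
rewrite [leRHS](bigD1 l) //= lerDl.
by apply: sumr_ge0 => k' _; apply: sumr_ge0 => j _; apply: nm_ge0.
Qed.

Lemma mnm_madj m n (A : 'M[V]_(m, n)) : mnm (madj A) = mnm A.
Proof.
rewrite /mnm exchange_big /=; apply: eq_bigr => i _; apply: eq_bigr => j _.
by rewrite !mxE nm_adj.
Qed.

Lemma mnm_scalar (a : V) : mnm (a%:M : 'M_1) = nm a.
Proof. by rewrite /mnm !big_ord1 mxE eqxx. Qed.

Lemma mnm_col m n (A : 'M[V]_(m, n)) j : mnm (col j A) <= mnm A.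
Proof.
apply: ler_sum => i _; rewrite big_ord1 mxE (bigD1 j) //= lerDl.
by apply: sumr_ge0 => l _; apply: nm_ge0.
Qed.

Lemma mnm_delta m n i j : mnm (delta_mx i j : 'M[V]_(m, n)) <= 1.
Proof.
rewrite /mnm (bigD1 i) //= [X in _ + X]big1 ?addr0 => [|k /negPf ki]; last first.
  by apply: big1 => l _; rewrite mxE ki nm0.
rewrite (bigD1 j) //= big1 ?addr0 => [|k /negPf kj]; last first.
  by rewrite mxE kj andbF nm0.
by rewrite mxE !eqxx nm1_le1.
Qed.

Definition gram n (h : 'cV[V]_n) : V := (madj h *m h) 0 0.

Lemma gramE n (h : 'cV[V]_n) : madj h *m h = (gram h)%:M.
Proof. exact: mx11_scalar. Qed.

Lemma pos_sum I (r : seq I) (F : I -> V) :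
  (forall i, pos (F i)) -> pos (\sum_(i <- r) F i).
Proof. by move=> h; apply: big_ind; [exact: pos0|exact: posD|]. Qed.

Lemma pos_gram n (h : 'cV[V]_n) : pos (gram h).
Proof.
by rewrite /gram mxE; apply: pos_sum => i; rewrite !mxE; apply: pos_adjM.
Qed.

Lemma nm_gram n (h : 'cV[V]_n) i : nm (h i 0) ^+ 2 <= nm (gram h).
Proof.
rewrite -nm_adjM; apply: pos_mono; first exact: pos_adjM.
rewrite /gram mxE (bigD1 i) //= !mxE addrC addrK.
elim/big_ind: _ => [||k _]; [exact: pos0|exact: posD|].
by rewrite !mxE; apply: pos_adjM.
Qed.

Lemma gram_scalar n (h : 'cV[V]_n) (c : V) :
  gram (h *m c%:M) = adj c * gram h * c.
Proof.
rewrite {1}/gram madjM madj_scalar -mulmxA [madj h *m _]mulmxA gramE.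
by rewrite -!scalar_mxM mxE mulrA.
Qed.

(** Pythagoras: the two inner squares differ by [gram (q *m h)]. *)
Lemma nm_gram_compl n (q : 'M[V]_n) (h : 'cV[V]_n) : madj q = q ->
  q *m q = q -> nm (gram (h - q *m h)) <= nm (gram h).
Proof.
move=> qq q2; apply: pos_mono; first exact: pos_gram.
suff -> : gram h - gram (h - q *m h) = gram (q *m h) by apply: pos_gram.
rewrite /gram -[LHS](_ : (madj h *m h - madj (h - q *m h) *m (h - q *m h)) 0 0 = _).
  congr (fun_of_matrix _ 0 0).
  rewrite madjB madjM qq mulmxBl !mulmxBr.
  rewrite -!mulmxA [q *m (q *m h)]mulmxA q2 subrr subr0.
  by rewrite opprB addrC subrK.
by rewrite [LHS]mxE [X in _ + X]mxE.
Qed.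

Section RangeProjection.
Variables (n : nat) (h : 'cV[V]_n) (p r : V).
Hypotheses (pp : adj p = p) (rr : adj r = r)
  (rp : r * p = r) (rhp : r * gram h * p = p).

(** The hypotheses make [r] the inverse of [p (gram h) p] in the corner of [p], so this is the
    projection onto the range of [h p]. *)
Definition range_proj : 'M[V]_n := h *m r%:M *m madj h.

Lemma range_proj_adj : madj range_proj = range_proj.
Proof.
by rewrite /range_proj !madjM madjK madj_scalar rr mulmxA.
Qed.

Lemma range_proj_idem : range_proj *m range_proj = range_proj.
Proof.
have pr : p * r = r by rewrite -[LHS]adjK adjM pp rr rp rr.
rewrite /range_proj -!mulmxA; congr (_ *m _).
rewrite [madj h *m (h *m _)]mulmxA gramE !mulmxA -!scalar_mxM.
by rewrite -{2}pr mulrA rhp pr.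
Qed.

(** [range_proj] absorbs [h p]; only [h (1 - p)] survives, and its inner square does not grow under
    the complementary projection. *)
Lemma range_proj_compl : nm (gram (h - range_proj *m h)) <=
  nm ((1 - p) * gram h * (1 - p)).
Proof.
have -> : h - range_proj *m h =
    h *m (1 - p)%:M - range_proj *m (h *m (1 - p)%:M).
  rewrite /range_proj -!mulmxA [madj h *m (h *m _)]mulmxA gramE -!scalar_mxM.
  rewrite -[X in X - _ = _]mulmx1 -!mulmxBr -!rmorphB /= mulrBr mulr1.
  congr (h *m scalar_mx _).
  have -> : 1 - p - r * (gram h - gram h * p) =
     1 - r * gram h + (r * gram h * p - p) by ncring.
  by rewrite rhp subrr addr0.
apply: le_trans (nm_gram_compl _ range_proj_adj range_proj_idem) _.
by rewrite gram_scalar adjB adj1 pp.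
Qed.

End RangeProjection.
End MatrixAdjoint.

Section MorphismMatrix.
Variables (R : realType) (V W : ucstarType R) (phi : {rmorphism V -> W}).
Hypotheses (phi_adj : {morph phi : x / adj x}).
Hypotheses (phi_sc : forall t, phi (sc t) = sc t).

Lemma map_madj m n (A : 'M[V]_(m, n)) :
  map_mx phi (madj A) = madj (map_mx phi A).
Proof. by apply/matrixP => i j; rewrite !mxE phi_adj. Qed.

Lemma mnm_map m n (A : 'M[V]_(m, n)) : mnm (map_mx phi A) <= mnm A.
Proof.
apply: ler_sum => i _; apply: ler_sum => j _; rewrite mxE.
exact: nm_morph.
Qed.

Lemma gram_map n (h : 'cV[V]_n) : gram (map_mx phi h) = phi (gram h).
Proof. by rewrite /gram -map_madj -map_mxM mxE. Qed.

End MorphismMatrix.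

(** * The projection attached to a composition of two maps *)

Section Composition.
Variables (R : realType) (V W X : ucstarType R).
Variables (phi : {rmorphism V -> W}) (psi : {rmorphism W -> X}).
Hypotheses (phi_adj : {morph phi : x / adj x}).
Hypotheses (phi_sc : forall t, phi (sc t) = sc t).
Hypotheses (psi_adj : {morph psi : x / adj x}).
Hypotheses (psi_sc : forall t, psi (sc t) = sc t).
Hypotheses (phi_cuts : cuts phi) (psi_cuts : cuts psi).

(* A bound for [|m|] that does not depend on the algebras or on the maps. *)
Definition coef_bound (k t : R) : R :=
  t^-1 + (1 + t^-1 * (k * k)) * t^-1 * (1 + t^-1 * (k * k)).

Lemma composition_proj (b : 'M[V]_2) (e : R) : madj b = b -> 0 < e ->
  exists m : 'M[X]_2,
  [/\ madj m = m, mnm m <= coef_bound (mnm b) (e ^+ 2 / 2) &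
   forall H Q, H = map_mx psi (map_mx phi b) -> Q = H *m m *m H ->
   Q *m Q = Q /\ forall i j, nm ((H - Q *m H) i j) <= e].
Proof.
(* Each cut leaves an inner square of norm at most [2 t = e^2], hence entries of norm at most
   [e]. *)
move=> bb e0; set t := e ^+ 2 / 2.
have t0 : 0 < t by rewrite divr_gt0 // exprn_gt0.
have ti0 : 0 <= t^-1 by rewrite invr_ge0 ltW.
pose h1 := map_mx phi (col 0 b); pose h2 := map_mx phi (col 1 b).
have [p1 [r1 [p1p1 p12 [r1r1 _] r1n [rp1 rsp1 n1]]]] :=
  cut_proj phi_adj phi_sc phi_cuts (pos_gram (col 0 b)) t0.
rewrite -gram_map // -/h1 in rsp1 n1.
pose q1 := range_proj h1 r1.
have q1q1 : madj q1 = q1 := range_proj_adj h1 r1r1.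
have q12 : q1 *m q1 = q1 := range_proj_idem p1p1 r1r1 rp1 rsp1.
(* Removing [q1] beforehand makes the range projection of [k'] orthogonal to [q1'], so that the two
   can be added. *)
pose k := h2 - q1 *m h2.
have [p2 [r2 [p2p2 p22 [r2r2 _] r2n [rp2 rsp2 n2]]]] :=
  cut_proj psi_adj psi_sc psi_cuts (pos_gram k) t0.
rewrite -gram_map // in rsp2 n2.
pose k' := map_mx psi k; rewrite -/k' in rsp2 n2.
pose q2 := range_proj k' r2.
have q2q2 : madj q2 = q2 := range_proj_adj k' r2r2.
have q22 : q2 *m q2 = q2 := range_proj_idem p2p2 r2r2 rp2 rsp2.
pose q1' := map_mx psi q1.
have q1k : q1' *m k' = 0.
  by rewrite -map_mxM mulmxBr mulmxA q12 subrr map_mx0.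
have q12o : q1' *m q2 = 0 by rewrite /q2 /range_proj !mulmxA q1k !mul0mx.
have q21o : q2 *m q1' = 0.
  have q1'q1' : madj q1' = q1' by rewrite -map_madj // q1q1.
  by rewrite -[LHS]madjK madjM q2q2 q1'q1' q12o; apply/matrixP => i j;
    rewrite !mxE adj0.
have q1'2 : q1' *m q1' = q1' by rewrite -map_mxM q12.
(* [q1 h2 = h1 (r1 c)] exhibits [k] as a combination of the columns of [phi b]. The vector [u] below
   records its coefficients: [k' = H u], so both projections factor through [H]. *)
pose c := (madj h1 *m h2) 0 0.
have q1h2 : q1 *m h2 = h1 *m (r1 * c)%:M.
  by rewrite /q1 /range_proj -!mulmxA [madj h1 *m h2]mx11_scalar scalar_mxM.
pose e1 : 'cV[X]_2 := delta_mx 0 0.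
pose u : 'cV[X]_2 := delta_mx 1 0 - e1 *m (psi (r1 * c))%:M.
pose m := e1 *m (psi r1)%:M *m madj e1 + u *m r2%:M *m madj u.
exists m; split.
- by rewrite madjD !madjM !madjK !madj_scalar r2r2 -psi_adj r1r1 !mulmxA.
- have e1n : mnm e1 <= 1 := mnm_delta _ _ _.
  have hn i : mnm (map_mx phi (col i b)) <= mnm b.
    exact: le_trans (mnm_map phi_adj phi_sc _) (mnm_col _ _).
  have cn : nm (psi (r1 * c)) <= t^-1 * (mnm b * mnm b).
    apply: le_trans (nm_morph psi_adj psi_sc _) _; apply: le_trans (nmM _ _) _.
    apply: ler_pM; rewrite ?nm_ge0 //; apply: le_trans (nm_le_mnm _ _ _) _.
    apply: le_trans (mnmM _ _) _; rewrite mnm_madj.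
    by apply: ler_pM; rewrite ?mnm_ge0 //; apply: hn.
  have un : mnm u <= 1 + t^-1 * (mnm b * mnm b).
    apply: le_trans (mnmB _ _) _; apply: lerD; first exact: mnm_delta.
    apply: le_trans (mnmM _ _) _; rewrite mnm_scalar -[leRHS]mul1r.
    by apply: ler_pM; rewrite ?mnm_ge0 ?nm_ge0.
  apply: le_trans (mnmD _ _) _; apply: lerD.
    apply: le_trans (mnmM _ _) _; rewrite mnm_madj -[leRHS]mulr1.
    apply: ler_pM; rewrite ?mnm_ge0 //.
    apply: le_trans (mnmM _ _) _; rewrite mnm_scalar -[leRHS]mul1r.
    apply: ler_pM; rewrite ?mnm_ge0 ?nm_ge0 //.
    exact: le_trans (nm_morph psi_adj psi_sc _) r1n.
  apply: le_trans (mnmM _ _) _; rewrite mnm_madj.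
  apply: ler_pM; rewrite ?mnm_ge0 //.
  apply: le_trans (mnmM _ _) _; rewrite mnm_scalar.
  by apply: ler_pM; rewrite ?mnm_ge0 ?nm_ge0.
move=> H Q HE ->.
have HH : madj H = H by rewrite HE -!map_madj // bb.
have He1 : H *m e1 = map_mx psi h1.
  by rewrite HE /h1 !map_col -colE.
have Hd2 : H *m delta_mx 1 0 = map_mx psi h2.
  by rewrite HE /h2 !map_col -colE.
have Hu : H *m u = k'.
  rewrite /u mulmxBr Hd2 mulmxA He1 -map_scalar_mx -map_mxM -q1h2.
  by rewrite -map_mxB.
have QE : H *m m *m H = q1' + q2.
  rewrite -{2}HH /m mulmxDr mulmxDl; congr (_ + _).
    rewrite -!mulmxA -madjM !mulmxA He1.
    by rewrite /q1' /q1 /range_proj !map_mxM /= map_scalar_mx map_madj.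
  by rewrite -!mulmxA -madjM !mulmxA Hu.
split.
  by rewrite QE mulmxDl !mulmxDr q1'2 q22 q12o q21o addr0 add0r.
have small (x : 'cV[X]_2) i : nm (gram x) <= t + t -> nm (x i 0) <= e.
  move=> h; rewrite -(@ler_pXn2r _ 2) ?nnegrE ?nm_ge0 ?(ltW e0) //.
  apply: le_trans (nm_gram _ _) _; apply: le_trans h _.
  by rewrite /t -splitr.
have colH (j : 'I_2) : col j (H - H *m m *m H *m H) =
    col j H - (q1' + q2) *m col j H.
  by rewrite QE !colE mulmxBl mulmxA.
move=> i j.
have -> : (H - H *m m *m H *m H) i j = (col j (H - H *m m *m H *m H)) i 0.
  by rewrite [RHS]mxE.
rewrite colH; apply: small.
have [->|j1] : j = 0 \/ j = 1.
  by case: j => -[|[|//]] ?; [left|right]; apply: val_inj.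
(* [1 - q1' - q2 = (1 - q2) (1 - q1')], and the extra factor does not increase the inner square left
   by the first cut. *)
- rewrite colE He1.
  have -> : map_mx psi h1 - (q1' + q2) *m map_mx psi h1 =
      map_mx psi (h1 - q1 *m h1) - q2 *m map_mx psi (h1 - q1 *m h1).
    rewrite map_mxB map_mxM -/q1' mulmxBr [q2 *m (q1' *m _)]mulmxA q21o mul0mx.
    by rewrite subr0 mulmxDl opprD addrA.
  apply: le_trans (nm_gram_compl _ q2q2 q22) _.
  rewrite gram_map //; apply: le_trans (nm_morph psi_adj psi_sc _) _.
  exact: le_trans (range_proj_compl p1p1 r1r1 rp1 rsp1) n1.
- rewrite j1 colE Hd2.
  have -> : map_mx psi h2 - (q1' + q2) *m map_mx psi h2 = k' - q2 *m k'.
    rewrite /k' map_mxB map_mxM -/q1' mulmxBr [q2 *m (q1' *m _)]mulmxA q21o.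
    by rewrite mul0mx subr0 mulmxDl opprD addrA.
  exact: le_trans (range_proj_compl p2p2 r2r2 rp2 rsp2) n2.
Qed.

End Composition.

(** * Corners of C*-algebras *)

Section RealNorm.
Variables (R : realType) (A : cstarAlgType R).
Local Open Scope complex_scope.
Local Open Scope cstar_scope.
Implicit Types (x y e : A) (t eps : R).

Definition rnorm x : R := complex.Re `|x|.

Lemma rnormE x : `|x| = (rnorm x)%:C.
Proof. by rewrite /rnorm RRe_real // normr_real. Qed.

Lemma rnorm0_eq0 x : rnorm x = 0 -> x = 0.
Proof. by move=> x0; apply/eqP; rewrite -normr_eq0 rnormE x0. Qed.

Lemma rnormN x : rnorm (- x) = rnorm x.
Proof. by rewrite /rnorm normrN. Qed.

Lemma rnorm_ge0 x : 0 <= rnorm x.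
Proof. by rewrite -ler0c -rnormE. Qed.

Lemma ler_rnormD x y : rnorm (x + y) <= rnorm x + rnorm y.
Proof. by rewrite -lecR rmorphD /= -!rnormE ler_normD. Qed.

Lemma rnormZ t x : rnorm (t%:C *: x) = `|t| * rnorm x.
Proof.
have h : `|t%:C| = `|t|%:C :> R[i] by rewrite normc_def /= expr0n addr0 sqrtr_sqr.
by apply: complexI; rewrite rmorphM /= -h -!rnormE normrZ.
Qed.

Lemma rnormM x y : rnorm (x ** y) <= rnorm x * rnorm y.
Proof. by rewrite -lecR rmorphM /= -!rnormE norm_amul. Qed.

Lemma rnorm_starM x : rnorm (star x ** x) = rnorm x ^+ 2.
Proof. by apply: complexI; rewrite rmorphXn /= -!rnormE norm_star_amul. Qed.

Lemma starN x : star (- x) = - star x.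
Proof. by apply: (addrI (star x)); rewrite -starD !subrr star0. Qed.

Lemma amulN x y : x ** (- y) = - (x ** y).
Proof. by apply: (addrI (x ** y)); rewrite -amulDr !subrr amul0r. Qed.

Lemma amulNl x y : (- x) ** y = - (x ** y).
Proof. by apply: (addrI (x ** y)); rewrite -amulDl !subrr amul0l. Qed.

Lemma cvg_rnormP T (F : set_system T) (FF : Filter F) (f : T -> A) l :
  f @ F --> l <->
  forall eps, 0 < eps -> \forall i \near F, rnorm (f i - l) < eps.
Proof.
rewrite cvgrPdistC_lt; split=> h eps e0.
  have e0' : 0 < eps%:C :> R[i] by rewrite ltcE /= eqxx.
  by apply: filterS (h _ e0') => i; rewrite rnormE ltcR.
have := e0; rewrite ltcE /= => /andP[/eqP ie re].
have -> : eps = (complex.Re eps)%:C by case: (eps) ie => a b /= ->.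
by apply: filterS (h _ re) => i; rewrite rnormE ltcR.
Qed.

(** The bounded [eta] replaces a convergent series of norms: increments telescope to differences of
    [eta], which are small once [eta] is close to its supremum. *)
Lemma rnorm_complete (u : nat -> A) (eta : nat -> R) (K : R) :
  (forall n, rnorm (u n.+1 - u n) <= eta n.+1 - eta n) ->
  (forall n, eta n <= K) ->
  exists l : A, forall eps : R, 0 < eps ->
    exists N : nat, forall n : nat, (N <= n)%N -> rnorm (u n - l) < eps.
Proof.
move=> ue eK.
have tele N n : rnorm (u (n + N)%N - u N) <= eta (n + N)%N - eta N.
  elim: n => [|n IH]; first by rewrite !subrr /rnorm normr0.
  have -> : u (n.+1 + N)%N - u N = (u (n + N).+1 - u (n + N)%N) + (u (n + N)%N - u N).
    by rewrite addrA subrK addSn.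
  apply: le_trans (ler_rnormD _ _) _.
  by have := ue (n + N)%N; rewrite addSn; lra.
pose E := [set eta n | n in setT].
have supE : has_sup E.
  by split; [exists (eta 0%N); exists 0%N|exists K => _ [n _ <-]].
have near_sup eps : 0 < eps -> exists N, forall n, rnorm (u (n + N)%N - u N) < eps.
  move=> e0; have [_ [N _ <-] hN] := sup_adherent e0 supE.
  exists N => n; apply: le_lt_trans (tele N n) _.
  have : eta (n + N)%N <= sup E.
    by apply: ub_le_sup; [case: supE|exists (n + N)%N].
  by lra.
have cu : cvg (u @ \oo).
  apply: cauchy_cvg; apply: cauchy_exP => eps e0.
  have := e0; rewrite ltcE /= => /andP[/eqP ie re].
  have [N hN] := near_sup _ re.
  exists (u N); exists N => // n /= Nn.
  rewrite -ball_normE /= -normrN opprB rnormE.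
  have -> : eps = (complex.Re eps)%:C by case: (eps) ie => a b /= ->.
  by rewrite ltcR -(subnK Nn).
exists (lim (u @ \oo)) => eps e0.
have /cvg_rnormP/(_ eps e0)[N _ hN] := cu.
by exists N => n Nn; apply: hN.
Qed.

Lemma rnorm_proj e : projection e -> rnorm e <= 1.
Proof.
move=> [ee e2]; have := rnorm_starM e; rewrite ee e2 => h.
by have := rnorm_ge0 e; nra.
Qed.

End RealNorm.

(** Bundled, so that the type [corner e] and its instances are indexed by [e] alone. *)
Structure proj_elt (R : realType) (A : cstarAlgType R) := ProjElt {
  pval : A ;
  pvalP : projection pval
}.

Section Corner.
Variables (R : realType) (A : cstarAlgType R) (e : proj_elt A).
Local Open Scope complex_scope.
Local Open Scope cstar_scope.

Definition in_corner : {pred A} :=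
  fun x => `[< pval e ** x = x /\ x ** pval e = x >].

Record corner := Corner { cval : A ; cvalP : cval \in in_corner }.

HB.instance Definition _ := [isSub for cval].
HB.instance Definition _ := [Choice of corner by <:].

Lemma cval_inj : injective cval. Proof. exact: val_inj. Qed.

Lemma in_cornerP x :
  reflect (pval e ** x = x /\ x ** pval e = x) (x \in in_corner).
Proof. exact: asboolP. Qed.

Fact in_corner_zmod_closed : zmod_closed in_corner.
Proof.
split=> [|x y]; first by apply/in_cornerP; rewrite amul0l amul0r.
move=> /in_cornerP[h1 h2] /in_cornerP[h3 h4]; apply/in_cornerP.
by rewrite amulDr amulDl amulN amulNl h1 h2 h3 h4.
Qed.

HB.instance Definition _ :=
  GRing.isZmodClosed.Build A in_corner in_corner_zmod_closed.
HB.instance Definition _ := [SubChoice_isSubZmodule of corner by <:].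

Fact e_in_corner : pval e \in in_corner.
Proof. by apply/in_cornerP; have [] := pvalP e. Qed.

Fact amul_in_corner (x y : corner) : cval x ** cval y \in in_corner.
Proof.
have /in_cornerP[h1 h2] := cvalP x; have /in_cornerP[h3 h4] := cvalP y.
by apply/in_cornerP; rewrite amulA h1 -amulA h4.
Qed.

Fact star_in_corner (x : corner) : star (cval x) \in in_corner.
Proof.
have /in_cornerP[h1 h2] := cvalP x; have [ee _] := pvalP e.
by apply/in_cornerP; rewrite -{1 2}ee -!starM h1 h2.
Qed.

Fact scale_in_corner c : c *: pval e \in in_corner.
Proof.
by apply/in_cornerP; have [_ e2] := pvalP e; rewrite amulZr amulZl e2.
Qed.

Definition corner1 := Corner e_in_corner.
Definition corner_mul x y := Corner (amul_in_corner x y).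
Definition corner_star x := Corner (star_in_corner x).
Definition corner_scalar c := Corner (scale_in_corner c).

Fact corner_mulA : associative corner_mul.
Proof. by move=> x y z; apply: cval_inj; rewrite /= amulA. Qed.

Fact corner_mul1l : left_id corner1 corner_mul.
Proof. by move=> x; apply: cval_inj; have /in_cornerP[] := cvalP x. Qed.

Fact corner_mul1r : right_id corner1 corner_mul.
Proof. by move=> x; apply: cval_inj; have /in_cornerP[] := cvalP x. Qed.

Fact corner_mulDl : left_distributive corner_mul +%R.
Proof. by move=> x y z; apply: cval_inj; rewrite /= amulDl. Qed.

Fact corner_mulDr : right_distributive corner_mul +%R.
Proof. by move=> x y z; apply: cval_inj; rewrite /= amulDr. Qed.

HB.instance Definition _ := GRing.Zmodule_isPzRing.Build corner
  corner_mulA corner_mul1l corner_mul1r corner_mulDl corner_mulDr.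

Definition corner_sc (t : R) := corner_scalar t%:C.
Definition corner_nm (x : corner) := rnorm (cval x).

Lemma corner_scalarMl c (x : corner) : cval (corner_scalar c * x) = c *: cval x.
Proof. by rewrite /= amulZl; have /in_cornerP[->] := cvalP x. Qed.

Lemma corner_scalarMr c (x : corner) : cval (x * corner_scalar c) = c *: cval x.
Proof. by rewrite /= amulZr; have /in_cornerP[_ ->] := cvalP x. Qed.

Fact corner_scB : {morph corner_sc : s t / s - t}.
Proof. by move=> s t; apply: cval_inj; rewrite /= rmorphB scalerBl. Qed.

Fact corner_scM : {morph corner_sc : s t / s * t}.
Proof.
by move=> s t; apply: cval_inj; rewrite corner_scalarMl /= rmorphM scalerA.
Qed.

Fact corner_sc1 : corner_sc 1 = 1.
Proof. by apply: cval_inj; rewrite /= rmorph1 scale1r. Qed.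

Fact corner_scC t x : corner_sc t * x = x * corner_sc t.
Proof. by apply: cval_inj; rewrite corner_scalarMl corner_scalarMr. Qed.

Fact corner_starK : involutive corner_star.
Proof. by move=> x; apply: cval_inj; rewrite /= starK. Qed.

Fact corner_starD : {morph corner_star : x y / x + y}.
Proof. by move=> x y; apply: cval_inj; rewrite /= starD. Qed.

Fact corner_starM x y : corner_star (x * y) = corner_star y * corner_star x.
Proof. by apply: cval_inj; rewrite /= starM. Qed.

Fact corner_star_scalar c :
  corner_star (corner_scalar c) = corner_scalar (conjc c).
Proof. by apply: cval_inj; rewrite /= starZ; have [->] := pvalP e. Qed.

Fact corner_star_sc t : corner_star (corner_sc t) = corner_sc t.
Proof. by rewrite corner_star_scalar conjc_real. Qed.

Definition corner_ii := corner_scalar 'i.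

Fact corner_iiC x : corner_ii * x = x * corner_ii.
Proof. by apply: cval_inj; rewrite corner_scalarMl corner_scalarMr. Qed.

Fact corner_iiM : corner_ii * corner_ii = -1.
Proof.
apply: cval_inj; rewrite corner_scalarMl /= scalerA -expr2 sqr_i.
by rewrite scaleN1r.
Qed.

Fact corner_star_ii : corner_star corner_ii = - corner_ii.
Proof.
rewrite corner_star_scalar; apply: cval_inj; rewrite /= -scaleNr.
by congr (_ *: _); apply/eqP; rewrite eq_complex /= oppr0 !eqxx.
Qed.

Fact corner_nm0_eq0 x : corner_nm x = 0 -> x = 0.
Proof. by move=> /rnorm0_eq0 x0; apply: cval_inj. Qed.

Fact corner_ler_nmD x y : corner_nm (x + y) <= corner_nm x + corner_nm y.
Proof. exact: ler_rnormD. Qed.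

Fact corner_nmZ t x : corner_nm (corner_sc t * x) = `|t| * corner_nm x.
Proof. by rewrite /corner_nm corner_scalarMl rnormZ. Qed.

Fact corner_nmM x y : corner_nm (x * y) <= corner_nm x * corner_nm y.
Proof. exact: rnormM. Qed.

Fact corner_nm_starM x : corner_nm (corner_star x * x) = corner_nm x ^+ 2.
Proof. exact: rnorm_starM. Qed.

(** Multiplication by [e] fixes every [u n], so [e l - l] has norm at most twice that of [u n - l];
    hence the limit stays in the corner. *)
Fact corner_complete (u : nat -> corner) (eta : nat -> R) (K : R) :
  (forall n, corner_nm (u n.+1 - u n) <= eta n.+1 - eta n) ->
  (forall n, eta n <= K) ->
  exists l : corner, forall eps : R, 0 < eps ->
    exists N : nat, forall n : nat, (N <= n)%N -> corner_nm (u n - l) < eps.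
Proof.
move=> ue eK; have [l hl] := rnorm_complete ue eK.
suff lP : l \in in_corner by exists (Corner lP).
have e1 := rnorm_proj (pvalP e).
apply/in_cornerP; split; apply/eqP; rewrite -subr_eq0; apply/eqP/rnorm0_eq0;
  apply/eqP; rewrite eq_le rnorm_ge0 andbT leNgt; apply/negP => h.
- have [|N /(_ N (leqnn N)) hN] := hl (rnorm (pval e ** l - l) / 2); first lra.
  have /in_cornerP[uN _] := cvalP (u N).
  have E : pval e ** l - l = (cval (u N) - l) - pval e ** (cval (u N) - l).
    by rewrite amulDr amulN uN opprB [RHS]addrC addrA subrK.
  have := ler_rnormD (cval (u N) - l) (- (pval e ** (cval (u N) - l))).
  have := rnormM (pval e) (cval (u N) - l).
  have := rnorm_ge0 (cval (u N) - l); rewrite -E rnormN; nra.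
- have [|N /(_ N (leqnn N)) hN] := hl (rnorm (l ** pval e - l) / 2); first lra.
  have /in_cornerP[_ uN] := cvalP (u N).
  have E : l ** pval e - l = (cval (u N) - l) - (cval (u N) - l) ** pval e.
    by rewrite amulDl amulNl uN opprB [RHS]addrC addrA subrK.
  have := ler_rnormD (cval (u N) - l) (- ((cval (u N) - l) ** pval e)).
  have := rnormM (cval (u N) - l) (pval e).
  have := rnorm_ge0 (cval (u N) - l); rewrite -E rnormN; nra.
Qed.

Lemma cval_sum I (r : seq I) (G : I -> corner) :
  cval (\sum_(i <- r) G i) = \sum_(i <- r) cval (G i).
Proof. exact: (big_morph cval). Qed.

HB.instance Definition _ := PzRing_isUCstar.Build R corner
  corner_scB corner_scM corner_sc1 corner_scC
  corner_starK corner_starD corner_starM corner_star_sc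
  corner_iiC corner_iiM corner_star_ii
  corner_nm0_eq0 corner_ler_nmD corner_nmZ corner_nmM corner_nm_starM
  corner_complete.

End Corner.

(** * Almost idempotent matrices *)

Section Idempotent.
Variables (R : realType) (V : ucstarType R) (n : nat).
Implicit Types (A b x y z P Q : 'M[V]_n).

#[local] Instance matrix_ops : @Ncring.Ring_ops 'M[V]_n 0 1 (fun x y => x + y)
  (fun x y => x * y) (fun x y => x - y) (fun x => - x) eq := {}.

#[local] Instance matrix_Ring : Ncring.Ring (Ro := matrix_ops) :=
  @pzRing_Ring 'M[V]_n.

Lemma mnm_le_eps A : (forall eps, 0 < eps -> mnm A <= eps) -> A = 0.
Proof.
move=> h; apply/matrixP => i j; rewrite mxE; apply: nm_le_eps => e e0.
exact: le_trans (nm_le_mnm A i j) (h e e0).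
Qed.

Lemma mnm0 : mnm (0 : 'M[V]_n) = 0.
Proof. by apply: big1 => i _; apply: big1 => j _; rewrite mxE nm0. Qed.

Lemma mnm_mulr A x : mnm (A * x) <= mnm A * mnm x.
Proof. exact: mnmM. Qed.

Lemma madj_mulr A x : madj (A * x) = madj x * madj A.
Proof. exact: madjM. Qed.

(** [P = P^* P] makes the inner square of a column its diagonal entry. This gives
    [nm (P j j) ^+ 2 <= nm (P j j)], then the bound for the rest of the column. *)
Lemma nm_proj_entry P i j : madj P = P -> P * P = P -> nm (P i j) <= 1.
Proof.
move=> PP P2; have gE k : gram (col k P) = P k k.
  have P2' : P *m P = P := P2.
  rewrite /gram -{3}P2' !mxE; apply: eq_bigr => l _.
  by rewrite !mxE -{3}PP !mxE.
have h k l : nm (P k l) ^+ 2 <= nm (P l l).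
  by have := nm_gram (col l P) k; rewrite gE mxE.
have hj : nm (P j j) <= 1 by have := h j j; have := nm_ge0 (P j j); nra.
by have := h i j; have := nm_ge0 (P i j); nra.
Qed.

Lemma mnm_proj P : madj P = P -> P * P = P -> mnm P <= (n * n)%:R.
Proof.
move=> PP P2; apply: (@le_trans _ _ (\sum_(i < n) \sum_(j < n) 1)).
  by apply: ler_sum => i _; apply: ler_sum => j _; apply: nm_proj_entry.
by rewrite !sumr_const !card_ord -mulrnA.
Qed.

Lemma mnm_complete (u : nat -> 'M[V]_n) (eta : nat -> R) (K : R) :
  (forall k, mnm (u k.+1 - u k) <= eta k.+1 - eta k) ->
  (forall k, eta k <= K) ->
  exists l, forall eps, 0 < eps -> exists N, forall k, (N <= k)%N ->
    mnm (u k - l) <= eps.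
Proof.
move=> ue eK.
have lims i j : exists l : V, forall eps : R, 0 < eps ->
    exists N : nat, forall k : nat, (N <= k)%N -> nm (u k i j - l) < eps.
  apply: (@nm_complete _ _ _ eta K) => // k; apply: le_trans (ue k).
  by have := nm_le_mnm (u k.+1 - u k) i j; rewrite !mxE.
have /choice[l hl] : forall ij : 'I_n * 'I_n, exists l : V, forall eps : R,
    0 < eps -> exists N : nat, forall k : nat, (N <= k)%N ->
    nm (u k ij.1 ij.2 - l) < eps by move=> ij; apply: lims.
exists (\matrix_(i, j) l (i, j)) => eps e0.
pose d := eps / ((n * n)%:R + 1).
have d0 : 0 < d by rewrite divr_gt0 // ltr_wpDl.
have /choice[N hN] : forall ij : 'I_n * 'I_n, exists N, forall k, (N <= k)%N ->
    nm (u k ij.1 ij.2 - l ij) < d by move=> ij; apply: hl.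
exists (\max_ij N ij)%N => k Nk.
apply: (@le_trans _ _ (\sum_(i < n) \sum_(j < n) d)).
  apply: ler_sum => i _; apply: ler_sum => j _; rewrite !mxE.
  apply/ltW/(hN (i, j)); apply: leq_trans Nk.
  exact: (leq_bigmax (i, j)).
rewrite !sumr_const !card_ord -mulrnA -[leLHS]mulr_natr /d mulrAC.
by rewrite ler_pdivrMr ?ltr_wpDl // ler_pM2l // lerDl.
Qed.

(** No closure is taken: the set is stable under sums and products, so every iterate of [smoothstep]
    stays in it and only the limit is approximated from it. *)
Definition in_her b z := exists x, z = b * x * b.

Lemma in_herM b y z : in_her b y -> in_her b z -> in_her b (y * z).
Proof. by move=> [x ->] [x' ->]; exists (x * b * b * x'); ncring. Qed.

Lemma in_herB b y z : in_her b y -> in_her b z -> in_her b (y - z).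
Proof. by move=> [x ->] [x' ->]; exists (x - x'); ncring. Qed.

Lemma in_herD b y z : in_her b y -> in_her b z -> in_her b (y + z).
Proof. by move=> [x ->] [x' ->]; exists (x + x'); ncring. Qed.

(** It fixes 0 and 1 with zero derivative, hence converges quadratically to idempotents, and it has
    no constant term, hence preserves hereditary subalgebras. *)
Definition smoothstep z := z * z + z * z + z * z - z * z * z - z * z * z.

(* With [d := z^2 - z], one step replaces [d] by [d^2 (4 d - 3)]. *)
Lemma smoothstep_defect z : let d := z * z - z in
  smoothstep z * smoothstep z - smoothstep z =
  d * d * d + d * d * d + d * d * d + d * d * d - d * d - d * d - d * d.
Proof. by rewrite /= /smoothstep; ncring. Qed.

Lemma smoothstep_sub z : let d := z * z - z in
  smoothstep z - z = d - d * z - d * z.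
Proof. by rewrite /= /smoothstep; ncring. Qed.

(** The contraction factor [1/4] comes from [4/256 + 3/16 < 1/4]. *)
Lemma mnm_smoothstep_defect z : mnm (z * z - z) <= 16^-1 ->
  mnm (smoothstep z * smoothstep z - smoothstep z) <= mnm (z * z - z) / 4.
Proof.
move=> d1; rewrite smoothstep_defect; set d := z * z - z in d1 *.
have d0 := mnm_ge0 d.
have d2 : mnm (d * d) <= mnm d / 16.
  by apply: le_trans (mnm_mulr _ _) _; rewrite ler_wpM2l.
have d3 : mnm (d * d * d) <= mnm d / 256.
  apply: le_trans (mnm_mulr _ _) _.
  have := mnm_ge0 (d * d); nra.
set x := d * d * d in d3 *; set y := d * d in d2 *.
have := mnmB (x + x + x + x - y - y) y; have := mnmB (x + x + x + x - y) y.
have := mnmB (x + x + x + x) y; have := mnmD (x + x + x) x.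
by have := mnmD (x + x) x; have := mnmD x x; lra.
Qed.

Lemma mnm_smoothstep_sub z :
  mnm (smoothstep z - z) <= mnm (z * z - z) * (1 + 2 * mnm z).
Proof.
rewrite smoothstep_sub; set d := z * z - z.
have h := mnm_mulr d z.
have := mnmB (d - d * z) (d * z); have := mnmB d (d * z); lra.
Qed.

(** The factor [16 (3 + 2 K)] serves twice: it brings the defect below [1/16], where
    [mnm_smoothstep_defect] applies, and the total displacement below [eta]. *)
Lemma quasi_projection b z (K eta : R) : madj z = z -> in_her b z ->
  mnm z <= K -> 0 < eta -> eta <= 1 ->
  mnm (z * z - z) * (16 * (3 + 2 * K)) <= eta ->
  exists P, [/\ madj P = P, P * P = P, mnm (P - z) <= eta &
    forall eps, 0 < eps -> exists x, mnm (P - b * x * b) <= eps].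
Proof.
move=> zz zb zK eta0 eta1; set d := mnm _ => dK.
have K0 : 0 <= K := le_trans (mnm_ge0 _) zK.
have d0 : 0 <= d := mnm_ge0 _.
pose u k := iter k smoothstep z.
pose q k : R := 4^-1 ^+ k.
have q0 k : 0 <= q k by rewrite exprn_ge0 // invr_ge0.
have q1 k : q k <= 1 by rewrite exprn_ile1 // ?invr_ge0 // invf_le1 //; lra.
have qS k : q k.+1 = q k / 4 by rewrite /q exprSr.
(* While the iterates have norm at most [K + 1], step [k] moves by at most [d (q k) (3 + 2 K)]; the
   factor 2 exceeds the sum [4/3] of the [q k]. *)
pose maj k := 2 * d * (3 + 2 * K) * (1 - q k).
have c0 : 0 <= d * (3 + 2 * K) by rewrite mulr_ge0 //; lra.
have step k : [/\ mnm (u k * u k - u k) <= d * q k, mnm (u k - z) <= maj k &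
    mnm (u k.+1 - u k) <= maj k.+1 - maj k].
  have tail j : mnm (u j * u j - u j) <= d * q j -> mnm (u j - z) <= maj j ->
      mnm (u j.+1 - u j) <= maj j.+1 - maj j.
    move=> h1 h2; apply: le_trans (mnm_smoothstep_sub _) _.
    have uj : mnm (u j) <= K + 1.
      have -> : u j = (u j - z) + z by rewrite subrK.
      apply: le_trans (mnmD _ _) _.
      suff : maj j <= 1 by lra.
      by have := q0 j; have := q1 j; rewrite /maj; nra.
    have -> : maj j.+1 - maj j = (d * q j) * (3 / 2 * (3 + 2 * K)).
      by rewrite /maj qS; field.
    apply: ler_pM; rewrite ?mnm_ge0 //; have := mnm_ge0 (u j); lra.
  suff h : mnm (u k * u k - u k) <= d * q k /\ mnm (u k - z) <= maj k.
    by have [h1 h2] := h; split => //; apply: tail.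
  elim: k => [|k [h1 h2]].
    by rewrite /u /maj /q expr0 mulr1 /= !subrr mulr0 mnm0.
  have h3 := tail k h1 h2; split.
    apply: le_trans (mnm_smoothstep_defect _) _.
      by apply: le_trans h1 _; have := q1 k; have := q0 k; nra.
    by rewrite qS mulrA ler_pM2r // invr_gt0.
  have -> : u k.+1 - z = (u k.+1 - u k) + (u k - z) by rewrite addrA subrK.
  by have := mnmD (u k.+1 - u k) (u k - z); lra.
have majb k : maj k <= eta by have := q0 k; have := q1 k; rewrite /maj; nra.
have /mnm_complete/(_ majb)[P hP] : forall k, mnm (u k.+1 - u k) <= maj k.+1 - maj k.
  by move=> k; have [] := step k.
have uz k : mnm (u k - z) <= eta by have [_ h _] := step k; apply: le_trans h _.
have uP eps : 0 < eps -> exists k, mnm (u k - P) <= eps /\ mnm (u k * u k - u k) <= eps.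
  move=> e0; have [N hN] := hP eps e0.
  have [k kP] : exists k, d * q k <= eps.
    (* Since [k (q k) <= 1], any [k] beyond [d / eps] will do. *)
    exists (Num.bound (d / eps)).
    have qle k : k%:R * q k <= 1.
      elim: k => [|k IH]; first by rewrite mul0r.
      by rewrite qS -natr1; have := q0 k; have := q1 k; nra.
    have := archi_boundP (divr_ge0 d0 (ltW e0)); set k := Num.bound _ => hk.
    have := qle k; rewrite ltr_pdivrMr // in hk; have := q0 k; nra.
  exists (maxn N k); split; first exact: hN (leq_maxl _ _).
  have [h _ _] := step (maxn N k); apply: le_trans h _; apply: le_trans kP.
  rewrite ler_wpM2l // /q ler_wiXn2l ?leq_maxr // ?invr_ge0 // invf_le1 //; lra.
exists P; split.
- apply/eqP; rewrite -subr_eq0; apply/eqP/mnm_le_eps => e e0.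
  have [|k [kP _]] := uP (e / 2); first lra.
  have uu : madj (u k) = u k.
    elim: k {kP} => [//|k IH]; rewrite /u iterS -/(u k) /smoothstep.
    by rewrite !(madjB, madjD, madj_mulr) IH !mulrA.
  have -> : madj P - P = (u k - P) - madj (u k - P) by rewrite madjB uu; ncring.
  by apply: le_trans (mnmB _ _) _; rewrite mnm_madj; lra.
- apply/eqP; rewrite -subr_eq0; apply/eqP/mnm_le_eps => e e0.
  pose M := mnm P + (K + 1) + 2; have P0 := mnm_ge0 P.
  have [|k [k1 k2]] := uP (e / M); first by rewrite divr_gt0 // /M; lra.
  have -> : P * P - P = (u k * u k - u k) + (u k - P) - (u k - P) * P
      - u k * (u k - P) by ncring.
  apply: le_trans (mnmB _ _) _.
  have h1 := mnmB (u k * u k - u k + (u k - P)) ((u k - P) * P).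
  have h2 := mnmD (u k * u k - u k) (u k - P).
  have h3 := mnm_mulr (u k - P) P; have h4 := mnm_mulr (u k) (u k - P).
  have h5 : mnm (u k) <= K + 1.
    have -> : u k = (u k - z) + z by rewrite subrK.
    by have := uz k; have := mnmD (u k - z) z; lra.
  have h6 := mnm_ge0 (u k); have h7 := mnm_ge0 (u k - P).
  have -> : e = e / M * M by rewrite divfK // gt_eqF // /M; lra.
  set w := e / M in k1 k2 *; rewrite /M; nra.
- rewrite leNgt; apply/negP => h.
  have [|k [kP _]] := uP ((mnm (P - z) - eta) / 2); first lra.
  have := uz k; have := mnmB (u k - z) (u k - P).
  have -> : u k - z - (u k - P) = P - z by ncring.
  lra.
- move=> e e0; have [k [kP _]] := uP e e0.
  have [x ux] : in_her b (u k).
    elim: k {kP} => [//|k IH]; rewrite /u iterS -/(u k) /smoothstep.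
    by do !(apply: in_herB || apply: in_herD || apply: in_herM).
  by exists x; rewrite -ux -mnmN opprB.
Qed.

End Idempotent.
#[local] Existing Instances matrix_ops matrix_Ring.

(** * Transport of projections along a filter *)

Section AsymptoticCalculus.
Variables (R : realType) (V : ucstarType R) (n : nat).
Variables (I : Type) (F : set_system I) (FF : ProperFilter F).
Implicit Types (u v w : I -> 'M[V]_n) (b : 'M[V]_n).

Definition bdd u := exists K, \forall i \near F, mnm (u i) <= K.

Definition aeq u v := forall eps : R, 0 < eps ->
  \forall i \near F, mnm (u i - v i) < eps.

Lemma aeq_near u v : (\forall i \near F, u i = v i) -> aeq u v.
Proof. by move=> h e e0; apply: filterS h => i ->; rewrite subrr mnm0. Qed.

Lemma aeq_sym u v : aeq u v -> aeq v u.
Proof.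
by move=> h e /h; apply: filterS => i; rewrite -mnmN opprB.
Qed.

Lemma aeq_trans v u w : aeq u v -> aeq v w -> aeq u w.
Proof.
move=> uv vw e e0; have e2 : 0 < e / 2 by lra.
apply: filterS2 (uv _ e2) (vw _ e2) => i.
have -> : u i - w i = (u i - v i) + (v i - w i) by ncring.
by have := mnmD (u i - v i) (v i - w i); lra.
Qed.

Lemma bdd_cst b : bdd (fun=> b).
Proof. by exists (mnm b); apply: nearW. Qed.

Lemma bdd_mul u v : bdd u -> bdd v -> bdd (fun i => u i * v i).
Proof.
move=> [K hK] [L hL]; exists (K * L); apply: filterS2 hK hL => i h1 h2.
by apply: le_trans (mnm_mulr _ _) _; apply: ler_pM; rewrite ?mnm_ge0.
Qed.

Lemma bdd_madj u : bdd u -> bdd (fun i => madj (u i)).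
Proof. by move=> [K hK]; exists K; apply: filterS hK => i; rewrite mnm_madj. Qed.

Lemma aeq_madj u v : aeq u v -> aeq (fun i => madj (u i)) (fun i => madj (v i)).
Proof.
by move=> h e /h; apply: filterS => i; rewrite -madjB mnm_madj.
Qed.

Lemma aeqMl u v w : bdd u -> aeq v w ->
  aeq (fun i => u i * v i) (fun i => u i * w i).
Proof.
move=> [K hK] vw e e0; pose d := e / (`|K| + 1).
have K1 : 0 < `|K| + 1 by rewrite ltr_wpDl.
have d0 : 0 < d by rewrite divr_gt0.
apply: filterS2 hK (vw d d0) => i h1 h2; rewrite -mulrBr.
apply: le_lt_trans (mnm_mulr _ _) _.
have -> : e = (`|K| + 1) * d by rewrite mulrC divfK // gt_eqF.
apply: le_lt_trans (_ : _ <= `|K| * d) _; last by rewrite ltr_pM2r // ltrDl.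
apply: ler_pM; rewrite ?mnm_ge0 ?(ltW h2) //.
exact: le_trans h1 (ler_norm K).
Qed.

Lemma aeqMr u v w : bdd u -> aeq v w ->
  aeq (fun i => v i * u i) (fun i => w i * u i).
Proof.
move=> bu vw; have := aeq_madj (aeqMl (bdd_madj bu) (aeq_madj vw)).
by move=> h e /h; apply: filterS => i; rewrite !madj_mulr !madjK.
Qed.

(* For point-norm limits, [s = g = 1] and [H i = theta_i b]; for Murray-von
   Neumann equivalence, [s i = v_i], [H = theta b] and [g = theta 1]. *)
Variables (b : 'M[V]_n) (s H m g : I -> 'M[V]_n) (c e : R).
Hypotheses (bb : madj b = b) (e0 : 0 < e).
Hypotheses (s_le : \forall i \near F, mnm (s i) <= c) (bH : bdd H) (bm : bdd m).
Hypotheses (mm : \forall i \near F, madj (m i) = m i).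
Hypotheses (HH : \forall i \near F, madj (H i) = H i).
Hypothesis ssg : aeq (fun i => madj (s i) * s i) g.
Hypotheses (Hg : \forall i \near F, H i * g i = H i).
Hypothesis sHs : aeq (fun i => s i * H i * madj (s i)) (fun=> b).
Let Q i := H i * m i * H i.
Hypothesis QQ : \forall i \near F, Q i * Q i = Q i.
Hypothesis QH : \forall i \near F, mnm (H i - Q i * H i) <= e.

Let z i := b * (s i * m i * madj (s i)) * b.

Let bs : bdd s. Proof. by exists c. Qed.

(** [s] intertwines [b] and [H]: [b s] is close to [s H s^* s], hence to [s H g = s H]. *)
Let b_s : aeq (fun i => b * s i) (fun i => s i * H i).
Proof.
apply: (aeq_trans (v := fun i => s i * H i * (madj (s i) * s i))).
  have := aeq_sym (aeqMr bs sHs).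
  by move=> h eps /h; apply: filterS => i; rewrite !mulrA.
apply: (aeq_trans (v := fun i => s i * H i * g i)).
  by apply: aeqMl ssg; apply: bdd_mul.
by apply: aeq_near; apply: filterS Hg => i h; rewrite -mulrA h.
Qed.

Let s_b : aeq (fun i => madj (s i) * b) (fun i => H i * madj (s i)).
Proof.
have h := aeq_madj b_s => eps /h h'.
by apply: filterS2 HH h' => i hi; rewrite !madj_mulr bb hi.
Qed.

Let bQ : bdd Q. Proof. by do !apply: bdd_mul. Qed.

(** Both outer factors [b] of [z] move past [s] and become the outer factors [H] of [Q]; boundedness
    of [m] is what keeps the error small. *)
Let zE : aeq z (fun i => s i * Q i * madj (s i)).
Proof.
apply: (aeq_trans (v := fun i => s i * H i * (m i * (madj (s i) * b)))).
  have : bdd (fun i => m i * (madj (s i) * b)).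
    by apply: bdd_mul bm (bdd_mul (bdd_madj bs) (bdd_cst b)).
  move=> /aeqMr /(_ b_s) h eps /h; apply: filterS => i.
  by rewrite /z !mulrA.
have : bdd (fun i => s i * H i * m i) by do !apply: bdd_mul.
move=> /aeqMl /(_ s_b) h eps /h; apply: filterS => i.
by rewrite /Q !mulrA.
Qed.

Let bz : bdd z.
Proof.
by do !apply: bdd_mul => //; try exact: bdd_cst; exact: bdd_madj.
Qed.

(** In [s Q s^* s Q s^*] the middle [s^* s] becomes [g], which [Q] absorbs because it ends in
    [H]. *)
Let zzE : aeq (fun i => z i * z i) z.
Proof.
have bss : bdd (fun i => s i * Q i * madj (s i)).
  by apply: bdd_mul (bdd_madj bs); apply: bdd_mul.
have bsQ : bdd (fun i => s i * Q i) by apply: bdd_mul.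
apply: (aeq_trans (aeqMr bz zE)); apply: (aeq_trans (aeqMl bss zE)).
apply: (aeq_trans _ (aeq_sym zE)).
have bQs : bdd (fun i => Q i * madj (s i)) by apply: bdd_mul (bdd_madj bs).
have h1 := aeqMl bsQ (aeqMr bQs ssg).
apply: (aeq_trans (v := fun i => s i * Q i * (g i * (Q i * madj (s i))))).
  by move=> eps /h1; apply: filterS => i; rewrite !mulrA.
apply: aeq_near; apply: filterS2 Hg QQ => i hg hQ.
have Qg : Q i * g i = Q i by rewrite /Q -[H i * m i * H i * g i]mulrA hg.
have -> : s i * Q i * (g i * (Q i * madj (s i))) =
  s i * (Q i * g i * Q i) * madj (s i) by rewrite !mulrA.
by rewrite Qg hQ.
Qed.

(** [b - z b] is close to [s (H - Q H) s^*], of norm at most [c e c]; the extra [e] pays for the two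
    approximations. *)
Let z_compl : \forall i \near F, mnm (b - z i * b) <= c * e * c + e.
Proof.
have bsQ : bdd (fun i => s i * Q i) by apply: bdd_mul.
have h1 : aeq (fun i => z i * b) (fun i => s i * Q i * (H i * madj (s i))).
  apply: (aeq_trans (aeqMr (bdd_cst b) zE)).
  have := aeqMl bsQ s_b.
  by move=> h eps /h; apply: filterS => i; rewrite !mulrA.
have e2 : 0 < e / 2 by rewrite divr_gt0.
apply: filterS2 (filterI (sHs e2) (h1 _ e2)) (filterI s_le QH) => i [h2 h3] [h4 h5].
have -> : b - z i * b = - (s i * H i * madj (s i) - b)
    - (z i * b - s i * Q i * (H i * madj (s i)))
    + s i * (H i - Q i * H i) * madj (s i) by ncring.
apply: le_trans (mnmD _ _) _; rewrite addrC; apply: lerD.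
  apply: le_trans (mnm_mulr _ _) _; rewrite mnm_madj.
  apply: ler_pM; rewrite ?mnm_ge0 //.
  by apply: le_trans (mnm_mulr _ _) _; apply: ler_pM; rewrite ?mnm_ge0.
by apply: le_trans (mnmB _ _) _; rewrite mnmN; lra.
Qed.

Lemma asymptotic_projection : exists P, [/\ madj P = P, P * P = P,
  mnm (b - P * b) <= c * e * c + e + e &
  forall eps, 0 < eps -> exists x, mnm (P - b * x * b) <= eps].
Proof.
have [K hK] := bz.
have b0 : 0 < mnm b + 1 by rewrite ltr_wpDl ?mnm_ge0.
(* Replacing [z i] by [P] then changes [z i * b] by at most [e]. *)
pose eta := Num.min 1 (e / (mnm b + 1)).
have eta0 : 0 < eta by rewrite lt_min ltr01 divr_gt0.
have eta1 : eta <= 1 by rewrite ge_min lexx.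
have etab : eta * mnm b <= e.
  have h : eta * (mnm b + 1) <= e.
    by rewrite -ler_pdivlMr // ge_min lexx orbT.
  by have := mnm_ge0 b; nra.
pose M := 16 * (3 + 2 * `|K|).
have M0 : 0 < M by rewrite mulr_gt0 // ltr_wpDr // mulr_ge0.
have [i [[h1 h2] [h3 h4]]] := filter_ex (filterI (filterI hK z_compl)
  (filterI mm (zzE (divr_gt0 eta0 M0)))).
have zz : madj (z i) = z i.
  by rewrite /z !madj_mulr !madjK bb h3 !mulrA.
have [|P [PP P2 Pz Pb]] := quasi_projection zz (ex_intro _ _ erefl)
  (le_trans h1 (ler_norm K)) eta0 eta1.
  by rewrite -/M -ler_pdivlMr // ltW.
exists P; split=> //.
have -> : b - P * b = (b - z i * b) - (P - z i) * b by ncring.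
apply: le_trans (mnmB _ _) _; apply: lerD => //.
apply: le_trans (mnm_mulr _ _) _; apply: le_trans etab.
by apply: ler_wpM2r => //; apply: mnm_ge0.
Qed.

End AsymptoticCalculus.

Lemma tails_filter (I : Type) (le : I -> I -> Prop) :
  directed le -> ProperFilter (tails le).
Proof.
move=> [[i0] lexx le_trans dir]; split.
  by move=> [i /(_ i (lexx i))].
split.
- by exists i0.
- move=> P Q [i hi] [j hj]; have [k [ik jk]] := dir i j.
  exists k => l kl; split; [exact: hi (le_trans _ _ _ ik kl)|].
  exact: hj (le_trans _ _ _ jk kl).
- by move=> P Q PQ [i hi]; exists i => j /hi; apply: PQ.
Qed.

(** * Star-homomorphisms between corners *)

Section StarHom.
Variables (R : realType) (A B : starAlgType R) (f : A -> B).
Hypothesis f_hom : star_hom f.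

Lemma star_homB : {morph f : x y / x - y}.
Proof.
have [fl _ _] := f_hom => x y.
by have := fl (-1) y x; rewrite !scaleN1r ![- _ + _]addrC.
Qed.

Lemma star_hom0 : f 0 = 0.
Proof. by rewrite -(subrr 0) star_homB subrr. Qed.

Lemma star_homZ c x : f (c *: x) = c *: f x.
Proof.
by have [fl _ _] := f_hom; have := fl c x 0; rewrite !addr0 star_hom0 addr0.
Qed.

Lemma star_homM : {morph f : x y / amul x y}.
Proof. by have [] := f_hom. Qed.

Lemma star_hom_star : {morph f : x / star x}.
Proof. by have [] := f_hom. Qed.

Lemma star_hom_proj e : projection e -> projection (f e).
Proof.
by move=> [ee e2]; split; rewrite -?star_hom_star -?star_homM ?ee ?e2.
Qed.

End StarHom.

Section CornerMap.
Variables (R : realType) (A B : cstarAlgType R) (f : A -> B).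
Hypothesis f_hom : star_hom f.
Variables (E : proj_elt A) (F : proj_elt B) (EF : pval F = f (pval E)).

Fact corner_map_subproof (x : corner E) : f (cval x) \in in_corner F.
Proof.
have /in_cornerP[h1 h2] := cvalP x.
by apply/in_cornerP; rewrite EF -!(star_homM f_hom) h1 h2.
Qed.

(** The target projection is a parameter tied to [f] by an equation: for point-norm limits it is the
    unit of [B], which is only provably equal to the image of [oneA]. *)
Definition corner_map x := Corner (corner_map_subproof x).

Fact corner_mapB : zmod_morphism corner_map.
Proof. by move=> x y; apply: cval_inj; rewrite /= (star_homB f_hom). Qed.

Fact corner_mapM : monoid_morphism corner_map.
Proof.
split=> [|x y]; apply: cval_inj => /=; first by rewrite EF.
exact: star_homM.
Qed.

HB.instance Definition _ :=
  GRing.isZmodMorphism.Build _ _ corner_map corner_mapB.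
HB.instance Definition _ :=
  GRing.isMonoidMorphism.Build _ _ corner_map corner_mapM.

Lemma corner_map_adj : {morph corner_map : x / adj x}.
Proof. by move=> x; apply: cval_inj; rewrite /= (star_hom_star f_hom). Qed.

Lemma corner_map_sc t : corner_map (sc t) = sc t.
Proof. by apply: cval_inj; rewrite /= (star_homZ f_hom) EF. Qed.

End CornerMap.

(** * Hereditary subalgebras and the cuts they supply *)

Section Hereditary.
Variables (R : realType) (A : cstarAlgType R).
Local Open Scope cstar_scope.
Implicit Types (b p x : A).

Lemma HerP b p : Her b p -> forall eps, 0 < eps ->
  exists x, rnorm (p - b ** x ** b) < eps.
Proof.
move=> pb eps e0; have e0' : 0 < eps%:C%C :> R[i] by rewrite ltcE /= eqxx.
have [_ [[x _ <-] hx]] := pb _ (nbhsx_ballx p _ e0').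
by exists x; move: hx; rewrite -ball_normE /= rnormE ltcR.
Qed.

Lemma mem_Her b x : Her b (b ** x ** b).
Proof. by apply: subset_closure; exists x. Qed.

(** [L] is abstract to cover both multiplication by an annihilator of [b] and [x |-> e x - x], which
    tests membership in a corner. *)
Lemma Her_vanish b p (L : A -> A) (K : R) : {morph L : x y / x - y} ->
  (forall x, rnorm (L x) <= K * rnorm x) ->
  (forall x, L (b ** x ** b) = 0) -> Her b p -> L p = 0.
Proof.
move=> LB LK Lb pb; apply: rnorm0_eq0; apply/eqP.
rewrite eq_le rnorm_ge0 andbT leNgt; apply/negP => Lp.
have K0 : 0 < K.
  rewrite ltNge; apply/negP => K0.
  by have := LK p; have := rnorm_ge0 p; nra.
have [|x hx] := HerP pb (eps := rnorm (L p) / K); first by rewrite divr_gt0.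
have := LK (p - b ** x ** b); rewrite LB Lb subr0.
by rewrite leNgt -ltr_pdivlMl // mulrC hx.
Qed.

Lemma Her_mull0 b p y : Her b p -> y ** b = 0 -> y ** p = 0.
Proof.
move=> pb yb; apply: (Her_vanish (K := rnorm y) _ _ _ pb).
- by move=> x z; rewrite amulDr amulN.
- by move=> x; apply: rnormM.
- by move=> x; rewrite !amulA yb !amul0l.
Qed.

Lemma Her_in_corner (F : proj_elt A) b p : pval F ** b = b -> b ** pval F = b ->
  Her b p -> p \in in_corner F.
Proof.
have F1 := rnorm_proj (pvalP F); move=> Fb bF pb; apply/in_cornerP.
split; apply/eqP; rewrite -subr_eq0; apply/eqP.
- apply: (Her_vanish (L := fun x => pval F ** x - x) (K := 2) _ _ _ pb).
  + by move=> x y; rewrite amulDr amulN !opprB addrACA [RHS]addrACA [X in _ + X = _]addrC.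
  + move=> x; apply: le_trans (ler_rnormD _ _) _; rewrite rnormN.
    by have := rnormM (pval F) x; have := rnorm_ge0 x; nra.
  + by move=> x; rewrite !amulA Fb subrr.
- apply: (Her_vanish (L := fun x => x ** pval F - x) (K := 2) _ _ _ pb).
  + by move=> x y; rewrite amulDl amulNl !opprB addrACA [RHS]addrACA [X in _ + X = _]addrC.
  + move=> x; apply: le_trans (ler_rnormD _ _) _; rewrite rnormN.
    by have := rnormM x (pval F); have := rnorm_ge0 x; nra.
  + by move=> x; rewrite -amulA bF subrr.
Qed.

End Hereditary.

Section Cuts.
Variables (R : realType) (V : ucstarType R).

Lemma nm_proj_sqr (q y : V) : adj q = q -> q * q = q -> adj y = y ->
  nm (q * y) ^+ 2 <= nm (q * (y * y)).
Proof.
move=> qq q2 yy; rewrite -nm_adj -nm_adjM adjK adjM yy qq.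
have -> : q * y * (y * q) = q * (y * y) * q by rewrite !mulrA.
apply: le_trans (nmM _ _) _; rewrite -[leRHS]mulr1.
by rewrite ler_wpM2l ?nm_ge0 ?nm_proj.
Qed.

(* By the C*-identity, ||q y||^2 <= ||q y^2|| for [y] self-adjoint and [q] a
   projection; this is iterated three times. *)
Lemma nm_proj_pow (q y : V) : adj q = q -> q * q = q -> adj y = y ->
  nm (q * y) ^+ 8 <= nm (q * (y * y * (y * y) * (y * y))) * nm (y * y).
Proof.
move=> qq q2 yy.
have h1 := nm_proj_sqr qq q2 yy.
have yy2 : adj (y * y) = y * y by rewrite adjM yy.
have h2 := nm_proj_sqr qq q2 yy2.
have yy4 : adj (y * y * (y * y)) = y * y * (y * y) by rewrite adjM yy2.
have h3 := nm_proj_sqr qq q2 yy4.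
have h4 := nmM (q * (y * y * (y * y) * (y * y))) (y * y).
rewrite -!mulrA in h1 h2 h3 h4 *; apply: le_trans h4; apply: le_trans h3.
rewrite (exprM _ 4 2) ler_pXn2r ?nnegrE ?exprn_ge0 ?nm_ge0 //.
apply: le_trans h2; rewrite (exprM _ 2 2).
by rewrite ler_pXn2r ?nnegrE ?exprn_ge0 ?nm_ge0.
Qed.

End Cuts.

(** Real rank zero concerns positive elements, so it is applied to [m^2], with image [b = y^2]. The
    approximate unit is tested on [b^3], which visibly has the form [b x b], and [nm_proj_pow]
    descends from there to [y]. If [n m = 0], then [phi n] kills [b] and hence all of [Her b]. *)
Lemma corner_map_cuts (R : realType) (A B : cstarAlgType R) (f : A -> B)
    (f_hom : star_hom f) (E : proj_elt A) (F : proj_elt B)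
    (EF : pval F = f (pval E)) :
  real_rank_zero f -> cuts (corner_map f_hom EF).
Proof.
move=> f_rr0 m mm e e0.
pose phi : {rmorphism corner E -> corner F} := corner_map f_hom EF.
have pos_m2 : positive (cval (m * m)).
  by exists (cval m); have /(congr1 (@cval _ _ _)) /= -> := mm.
have [I [le [p [dir pP /(_ _ (@mem_Her _ _ _ (cval (phi (m * m)))))[+ _]]]]] :=
  f_rr0 _ pos_m2.
have FF := tails_filter dir; move=> /cvg_rnormP hp.
pose y := phi m; pose b := phi (m * m).
have b_sqr : b = y * y by rewrite /b rmorphM.
have bE : f (cval (m * m)) = cval b by [].
have yy : adj y = y by rewrite /y -corner_map_adj mm.
pose d := e ^+ 8 / (nm b + 1).
have b1 : 0 < nm b + 1 by rewrite ltr_wpDl ?nm_ge0.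
have d0 : 0 < d by rewrite divr_gt0 ?exprn_gt0.
have [i hi] := filter_ex (hp d d0).
have [pH [pp p2]] := pP i.
have /in_cornerP[Fb bF] := cvalP b.
rewrite bE in pH hi.
have pF := Her_in_corner Fb bF pH.
pose q := Corner pF : corner F.
have qq : adj q = q by apply: cval_inj.
have q2 : q * q = q by apply: cval_inj.
exists q; split=> //.
- have c2 := proj_compl q2; have cc : adj (1 - q) = 1 - q by rewrite adjB adj1 qq.
  have h := nm_proj_pow cc c2 yy.
  rewrite -(@ler_pXn2r _ 8) ?nnegrE ?nm_ge0 ?(ltW e0) //; apply: le_trans h _.
  have -> : (1 - q) * (y * y * (y * y) * (y * y)) = - (q * (b * b * b) - b * b * b).
    by rewrite b_sqr; ncring.
  rewrite nmN -b_sqr; have hi' : nm (q * (b * b * b) - b * b * b) <= d.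
    exact: ltW hi.
  have -> : e ^+ 8 = d * (nm b + 1) by rewrite divfK // gt_eqF.
  apply: ler_pM; rewrite ?nm_ge0 //; lra.
- move=> n nm0; apply: cval_inj => /=; apply: (Her_mull0 pH).
  have /(congr1 phi)/(congr1 (@cval _ _ _)) : n * (m * m) = 0 by rewrite mulrA nm0 mul0r.
  by rewrite rmorphM rmorph0.
Qed.

(** * Amplifications *)

Section UnitalLift.
Variables (R : realType) (B : cstarAlgType R).
Variables (one : B) (unit1 : is_unit_elt one).
Local Open Scope cstar_scope.

Lemma unit_projection : projection one.
Proof.
split; last by have [] := unit1 one.
have [_ h] := unit1 (star one).
by rewrite -[RHS]starK -{2}h starM starK h.
Qed.

Definition unit_elt := ProjElt unit_projection.

Fact to_corner_subproof x : x \in in_corner unit_elt.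
Proof. by apply/in_cornerP; apply: unit1. Qed.

Definition to_corner x : corner unit_elt := Corner (to_corner_subproof x).

(** [one - f] is a projection of norm below 1, hence zero by the C*-identity. Norm convergence of
    projections to the unit thus becomes eventual equality. *)
Lemma near_unit_proj f : projection f -> rnorm (f - one) < 1 -> f = one.
Proof.
move=> [ff f2] f1; have [oo o2] := unit_projection.
pose g := to_corner (one - f).
have gg : adj g = g by apply: cval_inj; rewrite /= starD starN ff oo.
have g2 : g * g = g.
  apply: cval_inj; rewrite /= amulDl amulNl !(amulDr, amulN) f2 o2.
  by have [-> ->] := unit1 f; rewrite subrr subr0.
have := nm_herm_sqr gg; rewrite g2 => h.
have g1 : nm g < 1 by rewrite /nm /= /corner_nm /= -rnormN opprB.
have g0 : nm g = 0 by have := nm_ge0 g; nra.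
by apply/eqP; rewrite eq_sym -subr_eq0; apply/eqP; apply: rnorm0_eq0 g0.
Qed.

End UnitalLift.

Section MatrixTopology.
Variables (R : realType) (B : cstarAlgType R) (n : nat).

Lemma matalg_cvg (I : Type) (F : set_system I) (FF : Filter F)
    (f : I -> matalg n B) (l : matalg n B) :
  (forall i j (eps : R), 0 < eps -> \forall k \near F,
    rnorm ((f k : 'M[B]_n) i j - (l : 'M[B]_n) i j) < eps) ->
  f @ F --> l.
Proof.
move=> h U [P hP PU]; rewrite /= /nbhs /=.
suff : \forall k \near F, forall i j, P i j ((f k : 'M[B]_n) i j).
  by apply: filterS => k Pk; apply: PU.
apply: filter_forall => i; apply: filter_forall => j.
have /cvg_rnormP h' := h i j.
exact: h' (hP i j).
Qed.

Lemma matalg_nbhs (l : matalg n B) (eps : R) : 0 < eps ->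
  nbhs l [set y : matalg n B | forall i j,
    rnorm ((l : 'M[B]_n) i j - (y : 'M[B]_n) i j) < eps].
Proof.
move=> e0; have e0' : 0 < eps%:C%C :> R[i] by rewrite ltcE /= eqxx.
exists (fun i j => [set y | rnorm ((l : 'M[B]_n) i j - y) < eps]) => //= i j.
apply: filterS (nbhsx_ballx _ _ e0') => y.
by rewrite -ball_normE /= rnormE ltcR.
Qed.

Variables (one : B) (unit1 : is_unit_elt one).
Local Notation V := (corner (unit_elt unit1)).
Implicit Types (x y b h P : 'M[V]_n).

Definition to_matalg x : matalg n B := map_mx (@cval _ _ _) x.
Definition of_matalg (y : matalg n B) : 'M[V]_n := map_mx (to_corner unit1) (y : 'M[B]_n).

Lemma of_matalgK (y : matalg n B) : to_matalg (of_matalg y) = y.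
Proof. by apply/matrixP => i j; rewrite !mxE. Qed.

Lemma to_matalg_inj : injective to_matalg.
Proof.
by move=> x y /matrixP h; apply/matrixP => i j; apply: cval_inj;
  have := h i j; rewrite !mxE.
Qed.

Lemma to_matalgM x y : to_matalg (x * y) = amul (to_matalg x) (to_matalg y).
Proof.
apply/matrixP => i j; rewrite !mxE cval_sum.
by apply: eq_bigr => k _; rewrite !mxE.
Qed.

Lemma to_matalg_madj x : to_matalg (madj x) = star (to_matalg x).
Proof. by apply/matrixP => i j; rewrite !mxE. Qed.

Lemma nm_to_matalg x y i j :
  rnorm ((to_matalg x : 'M[B]_n) i j - (to_matalg y : 'M[B]_n) i j) =
  nm ((x - y) i j).
Proof. by rewrite !mxE. Qed.

Lemma to_matalg_cvg (I : Type) (F : set_system I) (FF : Filter F)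
    (f : I -> 'M[V]_n) l :
  (forall eps : R, 0 < eps -> \forall k \near F, mnm (f k - l) < eps) ->
  (fun k => to_matalg (f k)) @ F --> to_matalg l.
Proof.
move=> h; apply: matalg_cvg => i j eps /h; apply: filterS => k hk.
by apply: le_lt_trans hk; rewrite nm_to_matalg nm_le_mnm.
Qed.

Lemma nat_tails_directed : directed (fun i j : nat => (i <= j)%N).
Proof.
split; [exact: (inhabits 0%N)|exact: leqnn|by move=> i j k; apply: leq_trans|].
by move=> i j; exists (maxn i j); rewrite leq_maxl leq_maxr.
Qed.

Lemma near_tails_invSn (c eps : R) : 0 <= c -> 0 < eps ->
  \forall k \near tails (fun i j : nat => (i <= j)%N), k.+1%:R^-1 * c < eps.
Proof.
move=> c0 e0; exists (Num.bound (c / eps)) => k hk.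
rewrite mulrC ltr_pdivrMr ?ltr0Sn // mulrC -ltr_pdivrMr //.
apply: lt_le_trans (archi_boundP _) _; first by rewrite divr_ge0 // ltW.
by rewrite ler_nat leqW.
Qed.

Lemma to_matalg_HerP b h : Her (to_matalg b) (to_matalg h) <->
  forall eps : R, 0 < eps -> exists x, mnm (h - b * x * b) <= eps.
Proof.
split=> [hb eps e0|hb].
  pose d := eps / ((n * n)%:R + 1).
  have d0 : 0 < d by rewrite divr_gt0 // ltr_wpDl.
  have [_ [[y _ <-] hy]] := hb _ (matalg_nbhs (to_matalg h) d0).
  exists (of_matalg y).
  apply: (@le_trans _ _ (\sum_(i < n) \sum_(j < n) d)).
    apply: ler_sum => i _; apply: ler_sum => j _; apply/ltW.
    have yE := of_matalgK y.
    by have := hy i j; rewrite -{1}yE -!to_matalgM nm_to_matalg.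
  rewrite !sumr_const !card_ord -mulrnA -[leLHS]mulr_natr /d mulrAC.
  by rewrite ler_pdivrMr ?ltr_wpDl // ler_pM2l // lerDl.
have /choice[x hx] : forall k : nat, exists x, mnm (h - b * x * b) <= k.+1%:R^-1.
  by move=> k; apply: hb; rewrite invr_gt0 ltr0Sn.
have FF := tails_filter nat_tails_directed => U hU.
have : \forall k \near tails (fun i j : nat => (i <= j)%N),
    U (to_matalg (b * x k * b)).
  have h_cvg : (fun k => to_matalg (b * x k * b)) @
      tails (fun i j : nat => (i <= j)%N) --> to_matalg h.
    apply: to_matalg_cvg => eps e0.
    apply: filterS (near_tails_invSn ler01 e0) => k; rewrite mulr1 => hk.
    by apply: le_lt_trans hk; rewrite -mnmN opprB.
  exact: h_cvg hU.
move=> /filter_ex[k Uk]; exists (to_matalg (b * x k * b)); split=> //.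
by exists (to_matalg (x k)); rewrite // !to_matalgM.
Qed.

Lemma matalg_approx_unit b : madj b = b ->
  (forall eta : R, 0 < eta -> exists P, [/\ madj P = P, P * P = P,
    mnm (b - P * b) <= eta &
    forall eps : R, 0 < eps -> exists x, mnm (P - b * x * b) <= eps]) ->
  has_approx_unit_of_projections (Her (to_matalg b)).
Proof.
move=> bb hP.
have /choice[P {}hP] : forall k : nat, exists P, [/\ madj P = P, P * P = P,
    mnm (b - P * b) <= k.+1%:R^-1 &
    forall eps : R, 0 < eps -> exists x, mnm (P - b * x * b) <= eps].
  by move=> k; apply: hP; rewrite invr_gt0 ltr0Sn.
exists nat, (fun i j : nat => (i <= j)%N), (fun k => to_matalg (P k)).
have dir := nat_tails_directed; have FF := tails_filter dir.
split=> // [k|h].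
  have [PP P2 _ Pb] := hP k; split; first exact/to_matalg_HerP.
  by split; rewrite -?to_matalg_madj -?to_matalgM ?PP ?P2.
have conv x : Her (to_matalg b) (to_matalg x) -> forall eps : R, 0 < eps ->
    \forall k \near tails (fun i j : nat => (i <= j)%N), mnm (P k * x - x) < eps.
  move=> /to_matalg_HerP hx eps e0.
  set nn : R := (n * n)%:R; have nn0 : 0 <= nn by [].
  (* [nn] bounds all the [P k]; the [1] accounts for the term where [x - b * y * b] stands alone. *)
  pose N := nn + 1; have N0 : 0 < N by rewrite ltr_wpDl.
  have [|y hy] := hx (eps / 2 / N); first by rewrite !divr_gt0.
  have hy' : mnm (x - b * y * b) * N <= eps / 2 by rewrite -ler_pdivlMr.
  apply: filterS (near_tails_invSn (mnm_ge0 (y * b)) (divr_gt0 e0 (ltr0n _ 2))).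
  move=> k hk; have [PP P2 bP _] := hP k.
  have -> : P k * x - x = P k * (x - b * y * b) - (x - b * y * b)
     - (b - P k * b) * (y * b).
    by ncring.
  apply: le_lt_trans (mnmB _ _) _.
  have h1 := mnmB (P k * (x - b * y * b)) (x - b * y * b).
  have h2 := mnm_mulr (P k) (x - b * y * b); 
  have h3 : mnm (P k) <= nn := mnm_proj PP P2.
  have h4 := mnm_mulr (b - P k * b) (y * b).
  have h5 : mnm (b - P k * b) * mnm (y * b) <= k.+1%:R^-1 * mnm (y * b).
    by rewrite ler_wpM2r // mnm_ge0.
  have h6 : mnm (P k) * mnm (x - b * y * b) <= nn * mnm (x - b * y * b).
    by rewrite ler_wpM2r // mnm_ge0.
  apply: le_lt_trans (lerD (le_trans h1 (lerD (le_trans h2 h6) (lexx _)))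
    (le_trans h4 h5)) _.
  rewrite [ltRHS]splitr; apply: ler_ltD hk.
  by apply: le_trans hy'; rewrite /N mulrDr mulr1 mulrC.
rewrite -(of_matalgK h); move: (of_matalg h) => {}h hh; split.
  rewrite (_ : (fun k => _) = fun k => to_matalg (P k * h)); last first.
    by apply: funext => k; rewrite to_matalgM.
  by apply: to_matalg_cvg; apply: conv.
rewrite (_ : (fun k => _) = fun k => to_matalg (h * P k)); last first.
  by apply: funext => k; rewrite to_matalgM.
apply: to_matalg_cvg => eps e0.
(* Right multiplication reduces to left multiplication by adjoints, since [b] is self-adjoint. *)
have /conv/(_ eps e0) : Her (to_matalg b) (to_matalg (madj h)).
  apply/to_matalg_HerP => d d0; have /to_matalg_HerP/(_ d d0)[x hx] := hh.
  exists (madj x); rewrite -mnm_madj madjB !madj_mulr !madjK bb mulrA.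
  exact: hx.
apply: filterS => k; have [PP _ _ _] := hP k.
by rewrite -mnm_madj madjB madj_mulr madjK PP.
Qed.

End MatrixTopology.

Section ScalarMatrix.
Variables (R : realType) (V : ucstarType R) (n : nat).
Implicit Types (A : 'M[V]_n) (x : V).

Lemma mxE_scalar_mul x A i j : (x%:M * A) i j = x * A i j.
Proof.
rewrite [LHS]mxE (bigD1 i) //= mxE eqxx big1 ?addr0 // => k /negPf ki.
by rewrite mxE eq_sym ki mul0r.
Qed.

Lemma mxE_mul_scalar x A i j : (A * x%:M) i j = A i j * x.
Proof.
rewrite [LHS]mxE (bigD1 j) //= mxE eqxx big1 ?addr0 // => k /negPf ki.
by rewrite mxE ki mulr0.
Qed.

Lemma mnm_scalar_le x : nm x <= 1 -> mnm (x%:M : 'M_n) <= n%:R.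
Proof.
move=> x1; rewrite /mnm -[leRHS](_ : \sum_(i < n) 1 = _); last first.
  by rewrite sumr_const card_ord.
apply: ler_sum => i _; rewrite (bigD1 i) //= mxE eqxx big1 ?addr0 //.
by move=> j /negPf ji; rewrite mxE eq_sym ji nm0.
Qed.

Lemma aeq_entries (I : Type) (F : set_system I) (FF : Filter F)
    (u v : I -> 'M[V]_n) :
  (forall i j (eps : R), 0 < eps -> \forall k \near F, nm (u k i j - v k i j) < eps) ->
  aeq F u v.
Proof.
move=> h eps e0; pose d := eps / ((n * n)%:R + 1).
have d0 : 0 < d by rewrite divr_gt0 // ltr_wpDl.
have : \forall k \near F, forall i j, nm (u k i j - v k i j) < d.
  by apply: filter_forall => i; apply: filter_forall => j; apply: h.
apply: filterS => k hk.
apply: (@le_lt_trans _ _ (\sum_(i < n) \sum_(j < n) d)).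
  by apply: ler_sum => i _; apply: ler_sum => j _; rewrite !mxE; apply/ltW/hk.
rewrite !sumr_const !card_ord -mulrnA -[ltLHS]mulr_natr /d mulrAC.
by rewrite ltr_pdivrMr ?ltr_wpDl // ltr_pM2l // ltrDl.
Qed.

Lemma bdd_aeq (I : Type) (F : set_system I) (FF : Filter F) (u : I -> 'M[V]_n) b :
  aeq F u (fun=> b) -> bdd F u.
Proof.
move=> h; exists (1 + mnm b); apply: filterS (h 1 ltr01) => k hk.
have -> : u k = (u k - b) + b by rewrite subrK.
by apply: le_trans (mnmD _ _) _; rewrite lerD2r ltW.
Qed.

End ScalarMatrix.

(** * Two-by-two matrices under compositions of real rank zero maps *)

Section TwoByTwo.
Variables (R : realType) (A B C : cstarAlgType R).
Variables (alpha : A -> C) (beta : C -> B).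
Hypotheses (alpha_hom : star_hom alpha) (beta_hom : star_hom beta).
Hypotheses (alpha_rr0 : real_rank_zero alpha) (beta_rr0 : real_rank_zero beta).
Variables (E : proj_elt A) (F : proj_elt B) (EF : pval F = beta (alpha (pval E))).

Lemma mnm_le_entries (V : ucstarType R) (M : 'M[V]_2) (e : R) :
  (forall i j, nm (M i j) <= e) -> mnm M <= 4 * e.
Proof.
move=> h; apply: (@le_trans _ _ (\sum_(i < 2) \sum_(j < 2) e)).
  by apply: ler_sum => i _; apply: ler_sum => j _; apply: h.
by rewrite !sumr_const !card_ord -mulrnA -[leLHS]mulr_natl.
Qed.

(** The intermediate corner is taken at [alpha (pval E)], so [C] may lack a unit. The factor 4
    counts the entries. *)
Lemma composition_proj_corner (b : 'M[corner E]_2) (H : 'M[corner F]_2)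
    (e : R) :
  madj b = b -> 0 < e ->
  (forall i j, cval (H i j) = beta (alpha (cval (b i j)))) ->
  madj H = H /\ exists m : 'M[corner F]_2, [/\ madj m = m,
    mnm m <= coef_bound (mnm b) (e ^+ 2 / 2),
    H * m * H * (H * m * H) = H * m * H &
    mnm (H - H * m * H * H) <= 4 * e].
Proof.
move=> bb e0 hH.
pose G := ProjElt (star_hom_proj alpha_hom (pvalP E)).
pose phi : {rmorphism corner E -> corner G} :=
  corner_map alpha_hom (erefl : pval G = alpha (pval E)).
pose psi : {rmorphism corner G -> corner F} :=
  corner_map beta_hom (EF : pval F = beta (pval G)).
have phi_adj := corner_map_adj alpha_hom (erefl : pval G = alpha (pval E)).
have psi_adj := corner_map_adj beta_hom (EF : pval F = beta (pval G)).
have phi_sc := corner_map_sc alpha_hom (erefl : pval G = alpha (pval E)).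
have psi_sc := corner_map_sc beta_hom (EF : pval F = beta (pval G)).
have HE : H = map_mx psi (map_mx phi b).
  by apply/matrixP => i j; apply: cval_inj; rewrite hH !mxE.
split.
  rewrite HE -(map_madj psi_adj) -(map_madj phi_adj) bb //.
have [m [mm mn hm]] := composition_proj phi_adj phi_sc psi_adj psi_sc
  (corner_map_cuts alpha_hom _ alpha_rr0) (corner_map_cuts beta_hom _ beta_rr0) bb e0.
exists m; have [h1 h2] := hm H (H *m m *m H) HE erefl.
by split=> //; apply: mnm_le_entries.
Qed.

End TwoByTwo.

Section Main.
Variables (R : realType) (A B : cstarAlgType R) (oneA : A) (oneB : B).
Hypotheses (unitA : is_unit_elt oneA) (unitB : is_unit_elt oneB).
Variable iota : A -> B.
Hypotheses (hom_iota : star_hom iota) (iota1 : iota oneA = oneB).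

Local Notation VA := (corner (unit_elt unitA)).
Local Notation VB := (corner (unit_elt unitB)).

(** Formed for an arbitrary function: [corner_map] would require [f oneA = oneB], which along a net
    is available only eventually. *)
Definition lift_map (f : A -> B) (b : 'M[VA]_2) : 'M[VB]_2 :=
  map_mx (fun x => to_corner unitB (f (cval x))) b.

Lemma lift_map_herm b : madj b = b -> madj (lift_map iota b) = lift_map iota b.
Proof.
move=> bb; apply/matrixP => i j; apply: cval_inj; rewrite !mxE /=.
by rewrite -(star_hom_star hom_iota) -{2}bb !mxE.
Qed.

Lemma real_rank_zero_amplification :
  (forall (b : 'M[VA]_2) (e : R), madj b = b -> 0 < e -> exists P,
    [/\ madj P = P, P * P = P,
    mnm (lift_map iota b - P * lift_map iota b) <= e &
    forall eps : R, 0 < eps -> exists x,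
      mnm (P - lift_map iota b * x * lift_map iota b) <= eps]) ->
  real_rank_zero (amplification iota : matalg 2 A -> matalg 2 B).
Proof.
move=> h a [x ax]; pose b := of_matalg unitA a.
have bb : madj b = b.
  apply: to_matalg_inj; rewrite to_matalg_madj of_matalgK ax.
  by rewrite starM starK.
have -> : amplification iota a = to_matalg (lift_map iota b).
  by apply/matrixP => i j; rewrite !mxE.
apply: matalg_approx_unit => [|eta eta0]; last exact: h.
exact: lift_map_herm.
Qed.

End Main.

Section Approximation.
Variables (R : realType) (A B : cstarAlgType R) (oneA : A) (oneB : B).
Hypotheses (unitA : is_unit_elt oneA) (unitB : is_unit_elt oneB).
Variable iota : A -> B.
Hypotheses (hom_iota : star_hom iota) (iota1 : iota oneA = oneB).

Local Notation VA := (corner (unit_elt unitA)).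
Local Notation VB := (corner (unit_elt unitB)).

Lemma lift_map_cvg (I : Type) (F : set_system I) (FF : Filter F)
    (f : I -> A -> B) (b : 'M[VA]_2) :
  (forall a, (fun i => f i a) @ F --> iota a) ->
  aeq F (fun i => lift_map unitB (f i) b) (fun=> lift_map unitB iota b).
Proof.
move=> h; apply: aeq_entries => i j eps e0.
have /cvg_rnormP/(_ eps e0) := h (cval (b i j)).
by apply: filterS => k; rewrite !mxE.
Qed.

Lemma composition_limit (I : Type) (le : I -> I -> Prop)
    (C : I -> cstarAlgType R)
    (alpha : forall i, A -> C i) (beta : forall i, C i -> B) :
  directed le ->
  (forall i, star_hom (alpha i) /\ star_hom (beta i)) ->
  (forall i, real_rank_zero (alpha i) /\ real_rank_zero (beta i)) ->
  (forall a : A, (fun i => beta i (alpha i a)) @ tails le --> iota a) ->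
  real_rank_zero (amplification iota : matalg 2 A -> matalg 2 B).
Proof.
move=> dir homs rr0 lim; have FF := tails_filter dir.
apply: (@real_rank_zero_amplification _ _ _ _ _ unitA unitB _ hom_iota).
move=> b e bb e0.
(* The transport is applied with [c = 2], a bound for the norm of the identity matrix; its error
   [c d c + d + d = 6 d] is below [e]. *)
pose d : R := e / 8.
have d0 : 0 < d by rewrite divr_gt0.
pose bI := lift_map unitB iota b.
have bIbI : madj bI = bI by apply: lift_map_herm.
pose H i := lift_map unitB (fun a => beta i (alpha i a)) b.
have Hb : aeq (tails le) H (fun=> bI) by apply: lift_map_cvg.
have ev1 : \forall i \near tails le, beta i (alpha i oneA) = oneB.
  have /cvg_rnormP/(_ 1 ltr01) := lim oneA; apply: filterS => i.
  rewrite iota1; apply: near_unit_proj => //.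
  exact: (star_hom_proj (homs i).2
    (star_hom_proj (homs i).1 (unit_projection unitA))).
have /choice[m hm] : forall i, exists m : 'M[VB]_2,
    beta i (alpha i oneA) = oneB -> madj (H i) = H i /\
    [/\ madj m = m, mnm m <= coef_bound (mnm b) ((d / 4) ^+ 2 / 2),
      H i * m * H i * (H i * m * H i) = H i * m * H i &
      mnm (H i - H i * m * H i * H i) <= d].
  (* Off the tail where the units match, [0] is a dummy value. *)
  move=> i; have [f1|] := pselect (beta i (alpha i oneA) = oneB); last by exists 0.
  have d4 : 0 < d / 4 by rewrite divr_gt0.
  have [||HH [m [m1 m2 m3 m4]]] := composition_proj_corner (homs i).1 (homs i).2
    (rr0 i).1 (rr0 i).2 (E := unit_elt unitA) (F := unit_elt unitB)
    (H := H i) _ bb d4.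
  - by rewrite /= f1.
  - by move=> k l; rewrite mxE.
  exists m => _; split=> //; split=> //; apply: le_trans m4 _.
  by lra.
have mnm1 : mnm (1 : 'M[VB]_2) <= 2 by apply: mnm_scalar_le; apply: nm1_le1.
have [||||||||||P [PP P2 bP Pb]] := @asymptotic_projection R VB 2 I (tails le) FF
  bI (fun=> 1) H m (fun=> 1) 2 d bIbI d0.
- exact: nearW.
- exact: (bdd_aeq _ Hb).
- exists (coef_bound (mnm b) ((d / 4) ^+ 2 / 2)).
  by apply: filterS ev1 => i /hm[_ []].
- by apply: filterS ev1 => i /hm[_ []].
- by apply: filterS ev1 => i /hm[].
- by apply: aeq_near; apply: nearW => i; rewrite madj_scalar adj1 mulr1.
- by apply: nearW => i; rewrite mulr1.
- apply: aeq_trans Hb; apply: aeq_near; apply: nearW => i.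
  by rewrite madj_scalar adj1 mulr1 mul1r.
- by apply: filterS ev1 => i /hm[_ []].
- by apply: filterS ev1 => i /hm[_ []].
by exists P; split=> //; apply: le_trans bP _; rewrite /d; lra.
Qed.

Lemma MvN_composition (C : cstarAlgType R) (alpha : A -> C) (beta : C -> B) :
  star_hom alpha -> star_hom beta ->
  real_rank_zero alpha -> real_rank_zero beta ->
  approx_MvN_equivalent iota (fun a => beta (alpha a)) ->
  real_rank_zero (amplification iota : matalg 2 A -> matalg 2 B).
Proof.
move=> ha hb ra rb [I [le [v [dir v1 lim]]]]; have FF := tails_filter dir.
apply: (@real_rank_zero_amplification _ _ _ _ _ unitA unitB _ hom_iota).
move=> b e bb e0.
pose d : R := e / 8.
have d0 : 0 < d by rewrite divr_gt0.
have d4 : 0 < d / 4 by rewrite divr_gt0.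
pose bI := lift_map unitB iota b.
have bIbI : madj bI = bI by apply: lift_map_herm.
pose G' := ProjElt (star_hom_proj ha (unit_projection unitA)).
pose G := ProjElt (star_hom_proj hb (pvalP G')).
pose H0 : 'M[corner G]_2 :=
  map_mx (corner_map hb (erefl : pval G = beta (pval G')))
    (map_mx (corner_map ha (erefl : pval G' = alpha (pval (unit_elt unitA)))) b).
have [||HH [m [m1 m2 m3 m4]]] := composition_proj_corner ha hb
    ra rb (E := unit_elt unitA) (F := G) (H := H0) _ bb d4.
- by [].
- by move=> k l; rewrite !mxE.
(* This inclusion is multiplicative but need not preserve units, so its compatibility with matrix
   operations is checked directly. *)
pose inc (x : corner G) : VB := to_corner unitB (cval x).
have incM k l n (x : 'M[corner G]_(k, l)) (y : 'M[corner G]_(l, n)) :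
    map_mx inc (x *m y) = map_mx inc x *m map_mx inc y.
  apply/matrixP => i j; apply: cval_inj; rewrite !mxE /= !cval_sum.
  by apply: eq_bigr => o _; rewrite !mxE.
have incB k l (x y : 'M[corner G]_(k, l)) :
    map_mx inc (x - y) = map_mx inc x - map_mx inc y.
  by apply/matrixP => i j; apply: cval_inj; rewrite !mxE.
have inc_adj k l (x : 'M[corner G]_(k, l)) : madj (map_mx inc x) = map_mx inc (madj x).
  by apply/matrixP => i j; apply: cval_inj; rewrite !mxE.
have inc_mnm k l (x : 'M[corner G]_(k, l)) : mnm (map_mx inc x) = mnm x.
  by apply: eq_bigr => i _; apply: eq_bigr => j _; rewrite mxE.
pose s i : 'M[VB]_2 := (to_corner unitB (v i))%:M.
pose g : 'M[VB]_2 := (to_corner unitB (pval G))%:M.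
pose H : 'M[VB]_2 := map_mx inc H0; pose m' : 'M[VB]_2 := map_mx inc m.
have QE : H * m' * H = map_mx inc (H0 * m * H0).
  by rewrite /H /m' -[in RHS]/(H0 *m m *m H0) !incM.
have [||||||||||P [PP P2 bP Pb]] := @asymptotic_projection R VB 2 I (tails le) FF
  bI s (fun=> H) (fun=> m') (fun=> g) 2 d bIbI d0.
- apply: nearW => i; apply: mnm_scalar_le.
  by have := v1 i; rewrite rnormE -lecR.
- exact: bdd_cst.
- exact: bdd_cst.
- by apply: nearW => i; rewrite inc_adj m1.
- by apply: nearW => i; rewrite inc_adj HH.
(* At [oneA], the convergence of [v^* iota(a) v] says that [v^* v] tends to the projection
   [pval G]. *)
- apply: aeq_entries => i j eps eps0.
  have [/cvg_rnormP/(_ eps eps0) + _] := lim oneA.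
  apply: filterS => k; rewrite iota1; have [_ ->] := unitB (star (v k)).
  rewrite /s /g madj_scalar mxE_scalar_mul !mxE.
  case: (i == j); rewrite ?mulr1n ?mulr0n; first by [].
  by rewrite mulr0 subrr nm0.
- apply: nearW => _; apply/matrixP => i j; rewrite mxE_mul_scalar !mxE.
  apply: cval_inj => /=.
  by have /in_cornerP[] := cvalP (H0 i j); rewrite !mxE.
(* The other half of the equivalence, at the entries of [b], carries [H] back to [bI]. *)
- apply: aeq_entries => i j eps eps0.
  have [_ /cvg_rnormP/(_ eps eps0)] := lim (cval (b i j)).
  apply: filterS => k; rewrite /s madj_scalar mxE_mul_scalar mxE_scalar_mul.
  by rewrite !mxE.
- apply: nearW => _; rewrite QE -[LHS]incM; congr (map_mx inc _).
  exact: m3.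
- apply: nearW => _; rewrite QE -[_ * _]incM -incB inc_mnm.
  by apply: le_trans m4 _; lra.
by exists P; split=> //; apply: le_trans bP _; rewrite /d; lra.
Qed.

End Approximation.

Theorem corollary4p2 (R : realType) (A B : cstarAlgType R) (oneA : A) (oneB : B)
  (unitA : is_unit_elt oneA) (unitB : is_unit_elt oneB)
  (iota : A -> B) (hom_iota : star_hom iota) (iota1 : iota oneA = oneB)
  (not_rr0 : ~ real_rank_zero
     (amplification iota : matalg 2 A -> matalg 2 B)) :
  (~ exists (I : Type) (le : I -> I -> Prop) (C : I -> cstarAlgType R)
        (alpha : forall i, A -> C i) (beta : forall i, C i -> B),
      [/\ directed le,
          (forall i, star_hom (alpha i) /\ star_hom (beta i)),
          (forall i, real_rank_zero (alpha i) /\ real_rank_zero (beta i)) &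
          forall a : A, (fun i => beta i (alpha i a)) @ tails le --> iota a])
  /\
  (~ exists (C : cstarAlgType R) (alpha : A -> C) (beta : C -> B),
      [/\ star_hom alpha, star_hom beta,
          real_rank_zero alpha, real_rank_zero beta &
          approx_MvN_equivalent iota (fun a => beta (alpha a))]).
Proof.
split=> [[I [le [C [alpha [beta [dir homs rr0 lim]]]]]] | [C [alpha [beta]]]].
  by apply: not_rr0; apply: (composition_limit unitA unitB hom_iota) homs rr0 lim.
by move=> [ha hb ra rb mvn]; apply: not_rr0; apply: MvN_composition mvn.
Qed.
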